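(* Every infinite dimensional (i.e. infinite rank) normal operator $x$ in $L(s',s)$ has a spectral representation $$x=\sum_{n=1}^\infty\lambda_nP_n,$$ where $(\lambda_n)_{n\in\mathbb N}$ is a sequence belonging to $s$ of nonzero pairwise different complex numbers which is decreasing according to the modulus ($|\lambda_1|\ge|\lambda_2|\ge\cdots$), $(P_n)_{n\in\mathbb N}$ is a sequence of nonzero pairwise orthogonal finite dimensional projections belonging to $L(s',s)$, and the series converges absolutely in $L(s',s)$ (i.e. $\sum_n \|\lambda_nP_n\|_q<\infty$ for every $q\in\mathbb N_0$). This representation is unique, up to the ordering of terms whose $\lambda_n$ have equal modulus. Moreover, $(|\lambda_n|^\theta\|P_n\|_q)_{n\in\mathbb N}\in s$ for all $q\in\mathbb N_0$ and all $\theta\in(0,1]$.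
   Context: $\mathbb N=\{1,2,\dots\}$, $\mathbb N_0=\mathbb N\cup\{0\}$. $s$ is the Fréchet space of complex sequences $\xi=(\xi_j)_{j\in\mathbb N}$ with $|\xi|_q:=(\sum_{j}|\xi_j|^2j^{2q})^{1/2}<\infty$ for all $q\in\mathbb N_0$, with the topology of the norms $(|\cdot|_q)_{q\in\mathbb N_0}$. $s'$ is the space of complex sequences with $|\xi|'_q:=(\sum_j|\xi_j|^2j^{-2q})^{1/2}<\infty$ for some $q\in\mathbb N_0$, with the inductive limit topology. Note $s\subset l_2\subset s'$ continuously. $L(s',s)$ is the Fréchet space of continuous linear operators $x:s'\to s$ with norms $\|x\|_q:=\sup_{|\xi|'_q\le1}|x\xi|_q$, $q\in\mathbb N_0$. It is an algebra under composition (using $s\subset s'$). Restriction to $l_2$ embeds $L(s',s)$ into the algebra $K(l_2)$ of compact operators on $l_2$; via this embedding $L(s',s)$ is regarded as a subalgebra of $K(l_2)$, closed under the Hilbert space adjoint $x\mapsto x^*$, which is its involution. An operator on $l_2$ ''belongs to $L(s',s)$'' if it is the restriction of an element of $L(s',s)$. ''Normal'' means $xx^*=x^*x$. A projection is a continuous orthogonal (self-adjoint) projection on $l_2$; it is finite dimensional if its range is; projections $P,Q$ are orthogonal if $PQ=0$. *)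

(* Defs.v *)
From HB Require Import structures.
From mathcomp Require Import all_boot all_order all_algebra.
From mathcomp Require Import all_classical all_reals all_analysis.
From mathcomp Require Export complex.
From mathcomp Require Import lra.

Set Implicit Arguments.
Unset Strict Implicit.
Unset Printing Implicit Defensive.

Import Order.TTheory GRing.Theory Num.Theory Normc.
Import numFieldNormedType.Exports.

Local Open Scope classical_set_scope.
Local Open Scope ring_scope.
Local Open Scope complex_scope.

Section WeightedNorm.
Context {R : realType}.
Implicit Types (k : int) (xi eta : nat -> R[i]).

(* A sequence indexed by {1, 2, ...} is a function on nat: the entry of index j
   is [xi j.-1], so [xi j] carries the weight (j+1)^(2k).  For q : nat,
   [wnorm q%:Z] is the norm |.|_q, [wnorm (- q%:Z)] is the norm |.|'_q, and
   [wnorm 0] is the norm of l_2.  All norms take values in [0, +oo]. *)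
Definition wsum k xi : \bar R :=
  (\sum_(0 <= j <oo) (normc (xi j) ^+ 2 * (j.+1%:R : R) ^ (2 * k))%:E)%E.

Definition wnorm k xi : \bar R := sqrte (wsum k xi).

Lemma wterm_ge0 k xi j : 0 <= normc (xi j) ^+ 2 * (j.+1%:R : R) ^ (2 * k).
Proof. by rewrite mulr_ge0 ?sqr_ge0// exprz_ge0. Qed.

Lemma wsum_ge0 k xi : (0 <= wsum k xi)%E.
Proof. by apply: nneseries_ge0 => j _ _; rewrite lee_fin wterm_ge0. Qed.

Lemma wnorm_lty k xi : (wnorm k xi < +oo)%E = (wsum k xi < +oo)%E.
Proof.
rewrite /wnorm; have := wsum_ge0 k xi.
by case: (wsum k xi) => [r| |]//= _; rewrite !ltry.
Qed.

Lemma wnorm0 k : wnorm k 0 = 0%E.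
Proof.
rewrite /wnorm /wsum eseries0 ?sqrte0// => j _ _.
by rewrite normc0 expr0n mul0r.
Qed.

Lemma wnorm_ltyD k xi eta : (wnorm k xi < +oo)%E -> (wnorm k eta < +oo)%E ->
  (wnorm k (xi + eta)%R < +oo)%E.
Proof.
rewrite !wnorm_lty => xiy etay.
apply: (@le_lt_trans _ _ (2%:E * (wsum k xi + wsum k eta))%E); last first.
  by rewrite lte_mul_pinfty// ?lte_add_pinfty.
rewrite /wsum -nneseriesD; try by move=> *; rewrite lee_fin wterm_ge0.
rewrite -nneseriesZl; last first.
  by move=> *; rewrite -EFinD lee_fin addr_ge0 ?wterm_ge0.
apply: lee_nneseries => [j _ _|j _]; first by rewrite lee_fin wterm_ge0.
rewrite -EFinD -EFinM lee_fin -mulrDl mulrA ler_wpM2r ?exprz_ge0//.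
have n0 (z : R[i]) : 0 <= normc z by case: z => a b /=; rewrite sqrtr_ge0.
apply: (@le_trans _ _ ((normc (xi j) + normc (eta j)) ^+ 2)).
  by rewrite lerXn2r ?nnegrE ?addr_ge0 ?n0// le_normcD.
have := sqr_ge0 (normc (xi j) - normc (eta j)).
rewrite sqrrB sqrrD.
move: (normc (xi j) ^+ 2) (normc (eta j) ^+ 2) (normc (xi j) * _) => a b c.
move=> h; rewrite -subr_ge0 (le_trans h)// le_eqVlt; apply/orP; left.
apply/eqP; rewrite mulr_natl mulr2n mulrnDl; lra.
Qed.

Lemma wnorm_ltyZ k (a : R[i]) xi : (wnorm k xi < +oo)%E ->
  (wnorm k (a *: xi)%R < +oo)%E.
Proof.
rewrite !wnorm_lty => xiy.
rewrite (_ : wsum k (a *: xi) = ((normc a ^+ 2)%:E * wsum k xi)%E).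
  by rewrite lte_mul_pinfty// lee_fin sqr_ge0.
rewrite /wsum -nneseriesZl; last by move=> *; rewrite lee_fin wterm_ge0.
apply: eq_eseriesr => j _; rewrite -EFinM; congr (_%:E).
by rewrite (_ : (a *: xi) j = a * xi j)// normcM exprMn -mulrA.
Qed.

End WeightedNorm.

Section SequenceSpaces.
Variable R : realType.

Definition in_s : {pred nat -> R[i]} :=
  fun xi => `[< forall q : nat, (wnorm q%:Z xi < +oo)%E >].

Definition in_sdual : {pred nat -> R[i]} :=
  fun xi => `[< exists q : nat, (wnorm (- q%:Z) xi < +oo)%E >].

Definition in_l2 : {pred nat -> R[i]} :=
  fun xi => `[< (wnorm 0 xi < +oo)%E >].

Lemma wnorm_mono (k l : int) (xi : nat -> R[i]) :
  k <= l -> (wnorm l xi < +oo)%E -> (wnorm k xi < +oo)%E.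
Proof.
rewrite !wnorm_lty => kl; apply: le_lt_trans.
apply: lee_nneseries => [j _ _|j _]; first by rewrite lee_fin wterm_ge0.
by rewrite lee_fin ler_wpM2l ?sqr_ge0// ler_weXz2l ?ler1n// ler_pM2l.
Qed.

Lemma in_s_submod_closed : submod_closed in_s.
Proof.
split; first by apply/asboolP => q; rewrite wnorm0 ltry.
move=> a xi eta /asboolP xis /asboolP etas; apply/asboolP => q.
by apply: wnorm_ltyD; [exact: wnorm_ltyZ|exact: etas].
Qed.

Lemma in_sdual_submod_closed : submod_closed in_sdual.
Proof.
split; first by apply/asboolP; exists 0%N; rewrite wnorm0 ltry.
move=> a xi eta /asboolP[p xip] /asboolP[q etaq].
apply/asboolP; exists (maxn p q); apply: wnorm_ltyD.
  by apply: wnorm_ltyZ; apply: wnorm_mono xip; rewrite lerN2 lez_nat leq_maxl.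
by apply: wnorm_mono etaq; rewrite lerN2 lez_nat leq_maxr.
Qed.

Lemma in_l2_submod_closed : submod_closed in_l2.
Proof.
split; first by apply/asboolP; rewrite wnorm0 ltry.
move=> a xi eta /asboolP xil /asboolP etal; apply/asboolP.
by apply: wnorm_ltyD => //; exact: wnorm_ltyZ.
Qed.

HB.instance Definition _ :=
  GRing.isSubmodClosed.Build _ _ in_s in_s_submod_closed.
HB.instance Definition _ :=
  GRing.isSubmodClosed.Build _ _ in_sdual in_sdual_submod_closed.
HB.instance Definition _ :=
  GRing.isSubmodClosed.Build _ _ in_l2 in_l2_submod_closed.

Record s_space := SSpace { s_val :> nat -> R[i]; s_valP : s_val \in in_s }.
HB.instance Definition _ := [isSub for s_val].
HB.instance Definition _ := [Choice of s_space by <:].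
HB.instance Definition _ := [SubChoice_isSubLmodule of s_space by <:].

Record sdual_space :=
  SdualSpace { sdual_val :> nat -> R[i]; sdual_valP : sdual_val \in in_sdual }.
HB.instance Definition _ := [isSub for sdual_val].
HB.instance Definition _ := [Choice of sdual_space by <:].
HB.instance Definition _ := [SubChoice_isSubLmodule of sdual_space by <:].

Record l2_space := L2Space { l2_val :> nat -> R[i]; l2_valP : l2_val \in in_l2 }.
HB.instance Definition _ := [isSub for l2_val].
HB.instance Definition _ := [Choice of l2_space by <:].
HB.instance Definition _ := [SubChoice_isSubLmodule of l2_space by <:].

Lemma s_sub_l2 (xi : s_space) : s_val xi \in in_l2.
Proof. by apply/asboolP; have /asboolP/(_ 0%N) := s_valP xi. Qed.

Lemma l2_sub_sdual (xi : l2_space) : l2_val xi \in in_sdual.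
Proof. by apply/asboolP; exists 0%N; have /asboolP := l2_valP xi. Qed.

Definition s_to_l2 (xi : s_space) : l2_space := L2Space (s_sub_l2 xi).
Definition l2_to_sdual (xi : l2_space) : sdual_space :=
  SdualSpace (l2_sub_sdual xi).

End SequenceSpaces.

Section Topologies.
Variable R : realType.

(* The locally convex topology generated by the norms |.|_q. *)
Definition open_s : set_system (s_space R) := [set O | forall xi, O xi ->
  exists q (e : R), 0 < e /\ forall eta : s_space R,
    (forall p : nat, (p <= q)%N -> (wnorm p%:Z (eta - xi)%R < e%:E)%E) -> O eta].

Lemma open_sT : open_s setT.
Proof. by move=> xi _; exists 0%N, 1. Qed.

Lemma open_sI : setI_closed open_s.
Proof.
move=> A B oA oB xi [/oA[p [d [d0 dA]]] /oB[q [e [e0 eB]]]].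
exists (maxn p q), (Num.min d e); split; first by rewrite lt_min d0.
move=> eta h; split; [apply: dA|apply: eB] => n np.
  apply: lt_le_trans (h n _) _; first by rewrite leq_max np.
  by rewrite lee_fin ge_min lexx.
apply: lt_le_trans (h n _) _; first by rewrite leq_max np orbT.
by rewrite lee_fin ge_min lexx orbT.
Qed.

Lemma open_s_bigU (I : Type) (f : I -> set (s_space R)) :
  (forall i, open_s (f i)) -> open_s (\bigcup_i f i).
Proof.
move=> of_ xi [i _ /of_[q [e [e0 h]]]]; exists q, e; split=> // eta /h fi.
by exists i.
Qed.

HB.instance Definition _ :=
  isOpenTopological.Build (s_space R) open_sT open_sI open_s_bigU.

Definition absolutely_convex (V : lmodType R[i]) (A : set V) : Prop :=
  forall (a b : R[i]) (x y : V),
    normc a + normc b <= 1 -> A x -> A y -> A (a *: x + b *: y).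

(* Basic 0-neighbourhoods of the (locally convex) inductive limit of the spaces
   {xi | |xi|'_q < oo}: the absolutely convex sets whose trace on each of these
   spaces is a 0-neighbourhood for |.|'_q. *)
Definition nbhs0_sdual (U : set (sdual_space R)) : Prop :=
  absolutely_convex U /\
  forall q : nat, exists2 e : R, 0 < e &
    forall eta : sdual_space R, (wnorm (- q%:Z) eta < e%:E)%E -> U eta.

Definition open_sdual : set_system (sdual_space R) := [set O | forall xi, O xi ->
  exists2 U, nbhs0_sdual U & forall eta, U eta -> O (xi + eta)].

Lemma open_sdualT : open_sdual setT.
Proof. by move=> xi _; exists setT => //; split=> // q; exists 1. Qed.

Lemma open_sdualI : setI_closed open_sdual.
Proof.
move=> A B oA oB xi [/oA[U [cU nU] UA] /oB[V [cV nV] VB]].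
exists (U `&` V); last by move=> eta [/UA ? /VB].
split=> [a b x y ab [Ux Vx] [Uy Vy]|q]; first by split; [exact: cU|exact: cV].
have [d d0 dU] := nU q; have [e e0 eV] := nV q.
exists (Num.min d e) => [|eta h]; first by rewrite lt_min d0.
split; [apply: dU|apply: eV]; apply: lt_le_trans h _;
  by rewrite lee_fin ge_min lexx ?orbT.
Qed.

Lemma open_sdual_bigU (I : Type) (f : I -> set (sdual_space R)) :
  (forall i, open_sdual (f i)) -> open_sdual (\bigcup_i f i).
Proof.
move=> of_ xi [i _ /of_[U nU h]]; exists U => // eta /h fi.
by exists i.
Qed.

HB.instance Definition _ :=
  isOpenTopological.Build (sdual_space R) open_sdualT open_sdualI open_sdual_bigU.

Definition open_l2 : set_system (l2_space R) := [set O | forall xi, O xi ->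
  exists2 e : R, 0 < e &
    forall eta : l2_space R, (wnorm 0 (eta - xi)%R < e%:E)%E -> O eta].

Lemma open_l2T : open_l2 setT.
Proof. by move=> xi _; exists 1. Qed.

Lemma open_l2I : setI_closed open_l2.
Proof.
move=> A B oA oB xi [/oA[d d0 dA] /oB[e e0 eB]].
exists (Num.min d e) => [|eta h]; first by rewrite lt_min d0.
split; [apply: dA|apply: eB]; apply: lt_le_trans h _;
  by rewrite lee_fin ge_min lexx ?orbT.
Qed.

Lemma open_l2_bigU (I : Type) (f : I -> set (l2_space R)) :
  (forall i, open_l2 (f i)) -> open_l2 (\bigcup_i f i).
Proof.
move=> of_ xi [i _ /of_[e e0 h]]; exists e => // eta /h fi.
by exists i.
Qed.

HB.instance Definition _ :=
  isOpenTopological.Build (l2_space R) open_l2T open_l2I open_l2_bigU.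

End Topologies.

Section Operators.
Variable R : realType.
Implicit Types (T S : l2_space R -> l2_space R).

(* The elements of L(s', s). *)
Record smooth_op := SmoothOp {
  smooth_fun :> {linear sdual_space R -> s_space R};
  smooth_continuous : continuous smooth_fun }.

(* Finite on continuous operators, so [fine (opnorm q x)] is then the real norm. *)
Definition opnorm (q : nat) (f : sdual_space R -> s_space R) : \bar R :=
  ereal_sup [set wnorm q%:Z (f xi) | xi in
    [set xi : sdual_space R | (wnorm (- q%:Z) xi <= 1)%E]].

Definition restr_l2 (x : smooth_op) : l2_space R -> l2_space R :=
  fun xi => s_to_l2 (x (l2_to_sdual xi)).

Definition inner (xi eta : l2_space R) : R[i] :=
  limn (series (fun j => complex.Re (xi j * (eta j)^*))) +i*
  limn (series (fun j => complex.Im (xi j * (eta j)^*))).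

Definition is_adjoint T S : Prop :=
  forall xi eta, inner (T xi) eta = inner xi (S eta).

(* An adjoint, when it exists, is unique. *)
Definition normal_op T : Prop :=
  exists2 S, is_adjoint T S & forall xi, T (S xi) = S (T xi).

Definition finite_rank T : Prop :=
  exists m (e : 'I_m -> l2_space R),
    forall xi, exists c : 'I_m -> R[i], T xi = \sum_(i < m) c i *: e i.

Definition projection T : Prop :=
  [/\ linear T, continuous T, (forall xi, T (T xi) = T xi) & is_adjoint T T].

Definition spectral_representation (x : smooth_op)
    (lam : nat -> R[i]) (P : nat -> smooth_op) : Prop :=
  [/\ [/\ lam \in @in_s R, (forall n, lam n != 0), injective lam &
         forall n, normc (lam n.+1) <= normc (lam n)],
      [/\ (forall n, projection (restr_l2 (P n))),
          (forall n, finite_rank (restr_l2 (P n))),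
          (forall n, exists xi, restr_l2 (P n) xi != 0) &
          forall m n, m <> n ->
            forall xi, restr_l2 (P m) (restr_l2 (P n) xi) = 0],
      (forall q,
        (\sum_(0 <= n <oo) opnorm q (fun xi => lam n *: P n xi) < +oo)%E) &
      (forall q, opnorm q
          (fun xi => x xi - \sum_(0 <= n < N) lam n *: P n xi)
        @[N --> \oo] --> 0%E)].

End Operators.

(* Main.v *)
(* A continuous operator x from s' to s is compact on l2, and an eigenvector u
   of norm one for lambda satisfies |lambda| |u|_q = |x u|_q <= C_q.

   Existence.  A compact self-adjoint operator which leaves the orthogonal of a
   set invariant has there an eigenvector with eigenvalue plus or minus its norm; applied
   to the real and imaginary parts of the normal operator x, this bounds x on
   the orthogonal of some of its eigenspaces by twice the largest remaining
   modulus of an eigenvalue.  Eigenvalues are picked by decreasing modulus, and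
   the remainders tend to 0 because the eigenvalues do.

   Decay.  n orthonormal vectors have a total mass at most N on the first N
   coordinates, whereas the bound on |u|_q puts most of the mass there when
   |lambda| is large: hence |lambda_n| n^q is bounded.  The interpolation
   |u|_q^2 <= |u| |u|_2q, iterated, improves |u|_q <= C / |lambda| to
   |u|_q <= C |lambda|^-e for every e > 0, so that |P_n|_q <= C |lambda_n|^-2e.

   Uniqueness.  In any representation the lambda_n are the nonzero eigenvalues
   of x, and P_n is the orthogonal projection onto the eigenspace. *)
From HB Require Import structures.
Require Import Defs.
From mathcomp Require Import all_boot all_order all_algebra.
From mathcomp Require Import all_classical all_reals all_analysis.
From mathcomp Require Import ring lra.

Set Implicit Arguments.
Unset Strict Implicit.
Unset Printing Implicit Defensive.

Import Order.TTheory GRing.Theory Num.Theory Normc.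
Import numFieldNormedType.Exports.

Local Open Scope classical_set_scope.
Local Open Scope ring_scope.
Local Open Scope complex_scope.

(** * The inner product of l2 *)

(** Spectral theory lives on [l_2], whereas the norms of L(s', s) are suprema over s'. The link is
    truncation: finite sequences are dense for each norm |.|'_q, so an operator norm over s' can be
    computed on [l_2] vectors ([opnorm_le_l2]), and an operator is determined by its restriction
    ([restr_ext]). The bound by twice the largest remaining modulus is not sharp, but it only has to
    make the remainders tend to 0 in the [l_2] norm. This identifies the sum of the series;
    convergence in the finer norms comes from a separate estimate of the single terms. The
    interpolation is forced by that estimate: the crude bound |u|_q <= C / |lambda| yields only
    |P_n|_q <= C |lambda_n|^-2, and multiplying by |lambda_n| does not compensate for it. An
    arbitrarily small exponent leaves a positive power of |lambda_n|, whose rapid decay then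
    controls everything, for every theta > 0. *)

Section ComplexNorm.
Variable R : realType.
Implicit Types z w : R[i].

Lemma normc_ge0 z : 0 <= normc z.
Proof. by case: z => a b /=; rewrite sqrtr_ge0. Qed.

Lemma normc_eq0 z : (normc z == 0) = (z == 0).
Proof. by apply/eqP/eqP => [/eq0_normc//|->]; rewrite normc0. Qed.

Lemma normc_gt0 z : (0 < normc z) = (z != 0).
Proof. by rewrite lt_def normc_ge0 andbT normc_eq0. Qed.

Lemma normc_sqr z : normc z ^+ 2 = complex.Re z ^+ 2 + complex.Im z ^+ 2.
Proof. by case: z => a b /=; rewrite sqr_sqrtr// addr_ge0 ?sqr_ge0. Qed.

Lemma normc_conj z : normc (conjc z) = normc z.
Proof. by case: z => a b /=; rewrite sqrrN. Qed.

Lemma conjcM z w : conjc (z * w) = conjc z * conjc w.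
Proof. exact: rmorphM. Qed.

Lemma conjcD z w : conjc (z + w) = conjc z + conjc w.
Proof. exact: rmorphD. Qed.

Lemma mulcJ z : z * conjc z = (normc z ^+ 2)%:C.
Proof.
rewrite normc_sqr; case: z => a b; simpc => /=.
by congr (_ +i* _); ring.
Qed.

Lemma normc_real (r : R) : normc r%:C = `|r|.
Proof. by rewrite /= expr0n/= addr0 sqrtr_sqr. Qed.

Lemma Re_le_normc z : `|complex.Re z| <= normc z.
Proof. by case: z => a b /=; rewrite -sqrtr_sqr ler_wsqrtr// lerDl sqr_ge0. Qed.

Lemma Im_le_normc z : `|complex.Im z| <= normc z.
Proof. by case: z => a b /=; rewrite -sqrtr_sqr ler_wsqrtr// lerDr sqr_ge0. Qed.

Lemma normc_le z : normc z <= `|complex.Re z| + `|complex.Im z|.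
Proof.
rewrite -(@ler_pXn2r _ 2)// ?nnegrE ?normc_ge0 ?addr_ge0// normc_sqr.
rewrite sqrrD !real_normK ?num_real// -addrA lerD2l lerDr mulrn_wge0//.
Qed.

Lemma normcB z w : normc (z - w) = normc (w - z).
Proof. by rewrite -opprB normcN. Qed.

Lemma ReD z w : complex.Re (z + w) = complex.Re z + complex.Re w.
Proof. by case: z; case: w. Qed.

Lemma ImD z w : complex.Im (z + w) = complex.Im z + complex.Im w.
Proof. by case: z; case: w. Qed.

Lemma ReM z w : complex.Re (z * w) =
  complex.Re z * complex.Re w - complex.Im z * complex.Im w.
Proof. by case: z; case: w => *; simpc. Qed.

Lemma ImM z w : complex.Im (z * w) =
  complex.Re z * complex.Im w + complex.Im z * complex.Re w.
Proof. by case: z; case: w => *; simpc. Qed.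

Lemma complexP z w :
  complex.Re z = complex.Re w -> complex.Im z = complex.Im w -> z = w.
Proof. by case: z; case: w => a b c d /= -> ->. Qed.

End ComplexNorm.

Section InnerProduct.
Variable R : realType.
Local Notation H := (l2_space R).
Implicit Types x y z : H.

Lemma l2_addE x y j : (x + y) j = x j + y j. Proof. by []. Qed.
Lemma l2_subE x y j : (x - y) j = x j - y j. Proof. by []. Qed.
Lemma l2_val_sum (I : Type) (r : seq I) (P : pred I) (F : I -> H) j :
  (\sum_(i <- r | P i) F i : H) j = \sum_(i <- r | P i) F i j.
Proof. by elim/big_rec2 : _ => //= i y1 y2 _ <-. Qed.

Lemma l2P x y : (forall j, x j = y j) -> x = y.
Proof. by move=> h; apply/val_inj/funext. Qed.

Lemma wsum0E (xi : nat -> R[i]) :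
  wsum 0 xi = (\sum_(0 <= j <oo) (normc (xi j) ^+ 2)%:E)%E.
Proof. by apply: eq_eseriesr => j _; rewrite mulr0 expr0z mulr1. Qed.

Lemma l2_cvg x : cvgn (series (fun j => normc (x j) ^+ 2)).
Proof.
apply: nnseries_is_cvg => [j|]; first exact: sqr_ge0.
have /asboolP := l2_valP x; rewrite wnorm_lty; apply: le_lt_trans.
by rewrite wsum0E.
Qed.

Lemma l2_cvg_prod x y (f : nat -> R) :
  (forall j, `|f j| <= normc (x j) * normc (y j)) -> cvgn (series f).
Proof.
move=> fxy; apply: normed_cvg.
apply: (@series_le_cvg _ _ ((fun j => normc (x j) ^+ 2) \+
                            (fun j => normc (y j) ^+ 2))) => [n|n|n|].
- exact: normr_ge0.
- by rewrite addr_ge0 ?sqr_ge0.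
- rewrite (le_trans (fxy n))//=; have := sqr_ge0 (normc (x n) - normc (y n)).
  have := mulr_ge0 (normc_ge0 (x n)) (normc_ge0 (y n)).
  rewrite sqrrB; lra.
- by apply: is_cvg_seriesD; exact: l2_cvg.
Qed.

Lemma cvg_innerRe x y :
  cvgn (series (fun j => complex.Re (x j * conjc (y j)))).
Proof.
by apply: (@l2_cvg_prod x y) => j; rewrite (le_trans (Re_le_normc _))// normcM normc_conj.
Qed.

Lemma cvg_innerIm x y :
  cvgn (series (fun j => complex.Im (x j * conjc (y j)))).
Proof.
by apply: (@l2_cvg_prod x y) => j; rewrite (le_trans (Im_le_normc _))// normcM normc_conj.
Qed.

Lemma innerDl x y z : inner (x + y) z = inner x z + inner y z.
Proof.
apply: complexP => /=; rewrite ?ReD ?ImD/=.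
  rewrite -(lim_seriesD (@cvg_innerRe _ _) (@cvg_innerRe _ _)).
  by congr (limn (series _)); apply/funext => j; rewrite mulrDl ReD.
rewrite -(lim_seriesD (@cvg_innerIm _ _) (@cvg_innerIm _ _)).
by congr (limn (series _)); apply/funext => j; rewrite mulrDl ImD.
Qed.

Lemma innerZl a x y : inner (a *: x) y = a * inner x y.
Proof.
have cR := @cvg_innerRe x y; have cI := @cvg_innerIm x y.
have sZ (f : nat -> R) (c : R) : cvgn (series f) -> c * limn (series f) = limn (series (c *: f)).
  by move=> cf; rewrite lim_seriesZ.
apply: complexP; rewrite ?ReM ?ImM/=.
  rewrite (sZ _ (complex.Re a) cR) (sZ _ (complex.Im a) cI).
  rewrite -lim_seriesB; try exact: is_cvg_seriesZ.
  by congr (limn (series _)); apply/funext => j; rewrite -mulrA ReM.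
rewrite (sZ _ (complex.Re a) cI) (sZ _ (complex.Im a) cR).
rewrite -lim_seriesD; try exact: is_cvg_seriesZ.
by congr (limn (series _)); apply/funext => j; rewrite -mulrA ImM.
Qed.

Lemma inner_conj x y : inner y x = conjc (inner x y).
Proof.
apply: complexP => /=.
  by congr (limn (series _)); apply/funext => j; case: (x j) (y j) => a b [c d]; simpc => /=; ring.
rewrite -(lim_seriesN (@cvg_innerIm _ _)).
congr (limn (series _)); apply/funext => j; rewrite -[RHS]/(- complex.Im (x j * conjc (y j))).
by case: (x j) (y j) => a b [c d]; simpc => /=; ring.
Qed.

Lemma innerZr a x y : inner x (a *: y) = conjc a * inner x y.
Proof. by rewrite inner_conj innerZl conjcM -inner_conj. Qed.

Lemma innerDr x y z : inner x (y + z) = inner x y + inner x z.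
Proof. by rewrite inner_conj innerDl conjcD -!inner_conj. Qed.

Lemma innerNl x y : inner (- x) y = - inner x y.
Proof. by rewrite -scaleN1r innerZl mulN1r. Qed.

Lemma innerNr x y : inner x (- y) = - inner x y.
Proof. by rewrite -scaleN1r innerZr rmorphN rmorph1 mulN1r. Qed.

Lemma innerBl x y z : inner (x - y) z = inner x z - inner y z.
Proof. by rewrite innerDl innerNl. Qed.

Lemma innerBr x y z : inner x (y - z) = inner x y - inner x z.
Proof. by rewrite innerDr innerNr. Qed.

Lemma inner0l x : inner 0 x = 0.
Proof. by rewrite -(scale0r 0) innerZl mul0r. Qed.

Lemma inner_coord0 x y : (forall j, x j * conjc (y j) = 0) -> inner x y = 0.
Proof.
move=> h; rewrite -(inner0l y); congr (limn (series _) +i* limn (series _));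
  by apply/funext => j; rewrite h mul0r.
Qed.

Lemma inner0r x : inner x 0 = 0.
Proof. by rewrite inner_conj inner0l conjc0. Qed.

Lemma inner_suml (I : Type) (r : seq I) (P : pred I) (F : I -> H) y :
  inner (\sum_(i <- r | P i) F i) y = \sum_(i <- r | P i) inner (F i) y.
Proof.
by elim/big_rec2 : _ => [|i y1 y2 _ <-]; rewrite ?inner0l ?innerDl.
Qed.

Lemma inner_sumr (I : Type) (r : seq I) (P : pred I) (F : I -> H) y :
  inner y (\sum_(i <- r | P i) F i) = \sum_(i <- r | P i) inner y (F i).
Proof.
by elim/big_rec2 : _ => [|i y1 y2 _ <-]; rewrite ?inner0r ?innerDr.
Qed.

Definition nrm2 x : R := limn (series (fun j => normc (x j) ^+ 2)).
Definition nrm x : R := Num.sqrt (nrm2 x).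

Lemma nrm2_ge0 x : 0 <= nrm2 x.
Proof.
apply: limr_ge; first exact: l2_cvg.
by near=> n; apply: sumr_ge0 => j _; exact: sqr_ge0.
Unshelve. all: by end_near. Qed.

Lemma nrm_ge0 x : 0 <= nrm x. Proof. exact: sqrtr_ge0. Qed.

Lemma sqr_nrm x : nrm x ^+ 2 = nrm2 x.
Proof. by rewrite sqr_sqrtr// nrm2_ge0. Qed.

Lemma inner_self x : inner x x = (nrm2 x)%:C.
Proof.
apply: complexP => /=.
  by congr (limn (series _)); apply/funext => j; rewrite mulcJ.
rewrite (_ : (fun _ => _) = (fun=> 0)); last first.
  by apply/funext => j; rewrite mulcJ.
rewrite (_ : series _ = fun=> 0) ?lim_cst//.
by apply/funext => n; rewrite /series/= big1.
Qed.

Lemma sum_nrm2_le x n : \sum_(0 <= j < n) normc (x j) ^+ 2 <= nrm2 x.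
Proof.
apply: (nondecreasing_cvgn_le _ (@l2_cvg x)).
by apply: nondecreasing_series => j _ _; exact: sqr_ge0.
Qed.

(** The way into [l2_space] for sequences known only through their coordinates, such as weak limits
    and tails: a uniform bound on finite sums is enough. *)
Lemma nrm2_leP (xi : nat -> R[i]) (M : R) :
  (forall n, \sum_(0 <= j < n) normc (xi j) ^+ 2 <= M) ->
  exists2 x : H, x = xi :> (nat -> R[i]) & nrm2 x <= M.
Proof.
move=> h; have xi2 : xi \in @in_l2 R.
  apply/asboolP; rewrite wnorm_lty; apply: (@le_lt_trans _ _ M%:E); last exact: ltry.
  rewrite wsum0E; apply: lime_le.
    by apply: is_cvg_nneseries => j _ _; rewrite lee_fin sqr_ge0.
  by near=> n; rewrite sumEFin lee_fin h.
exists (L2Space xi2) => //; apply: limr_le; first exact: l2_cvg.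
by near=> n; exact: h.
Unshelve. all: by end_near. Qed.

Lemma wnorm0E x : wnorm 0 x = (nrm x)%:E.
Proof.
rewrite /wnorm wsum0E (_ : (\sum_(0 <= j <oo) _)%E = (nrm2 x)%:E)//.
rewrite /nrm2 -EFin_lim; last exact: l2_cvg.
by congr (limn _); apply/funext => n; rewrite /= sumEFin.
Qed.

Lemma normc_coord x j : normc (x j) <= nrm x.
Proof.
rewrite -(@ler_pXn2r _ 2)// ?nnegrE ?normc_ge0 ?nrm_ge0// sqr_nrm.
apply: le_trans (sum_nrm2_le x j.+1).
by rewrite big_nat_recr//= lerDr sumr_ge0// => i _; exact: sqr_ge0.
Qed.

Lemma nrm_eq0 x : (nrm x == 0) = (x == 0).
Proof.
apply/eqP/eqP => [x0|->]; last first.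
  have := inner0l 0; rewrite inner_self => /complexI; rewrite /nrm => ->.
  exact: sqrtr0.
apply: l2P => j; apply: eq0_normc; apply/eqP.
by rewrite eq_le normc_ge0 -x0 normc_coord.
Qed.

Lemma nrm0 : nrm 0 = 0. Proof. by apply/eqP; rewrite nrm_eq0. Qed.

Lemma nrm_gt0 x : (0 < nrm x) = (x != 0).
Proof. by rewrite lt_def nrm_ge0 nrm_eq0 andbT. Qed.

Lemma nrm2Z a x : nrm2 (a *: x) = normc a ^+ 2 * nrm2 x.
Proof.
apply: complexI; rewrite -inner_self innerZl innerZr inner_self mulrA mulcJ.
by rewrite -rmorphM.
Qed.

Lemma nrmZ a x : nrm (a *: x) = normc a * nrm x.
Proof. by rewrite /nrm nrm2Z sqrtrM ?sqr_ge0// sqrtr_sqr ger0_norm ?normc_ge0. Qed.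

Lemma nrmN x : nrm (- x) = nrm x.
Proof. by rewrite -scaleN1r nrmZ normcN normc1 mul1r. Qed.

Lemma nrm2D x y : nrm2 (x + y) = nrm2 x + nrm2 y + complex.Re (inner x y) *+ 2.
Proof.
have := inner_self (x + y); rewrite innerDl !innerDr !inner_self.
rewrite (inner_conj x y) => /(congr1 (@complex.Re R)) /= <-.
by rewrite mulr2n; ring.
Qed.

Lemma nrm2B x y : nrm2 (x - y) = nrm2 x + nrm2 y - complex.Re (inner x y) *+ 2.
Proof.
rewrite nrm2D innerNr -!(sqr_nrm (- y)) nrmN sqr_nrm.
by case: (inner x y) => a b /=; rewrite mulNrn.
Qed.

(* Expand |<y,y> x - <x,y> y|^2 >= 0. *)
Lemma cauchy_schwarz x y : normc (inner x y) <= nrm x * nrm y.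
Proof.
have [->|y0] := eqVneq y 0; first by rewrite inner0r normc0 nrm0 mulr0.
have y2 : 0 < nrm2 y by rewrite -sqr_nrm exprn_gt0 ?nrm_gt0.
rewrite -(@ler_pXn2r _ 2)// ?nnegrE ?normc_ge0 ?mulr_ge0 ?nrm_ge0//.
rewrite exprMn !sqr_nrm -(ler_pM2l y2).
have := nrm2_ge0 ((nrm2 y)%:C *: x - inner x y *: y).
rewrite nrm2B !nrm2Z normc_real innerZl innerZr.
rewrite [conjc _ * _]mulrC mulcJ ger0_norm ?nrm2_ge0//=.
rewrite mul0r subr0; lra.
Qed.

Lemma nrmD x y : nrm (x + y) <= nrm x + nrm y.
Proof.
rewrite -(@ler_pXn2r _ 2)// ?nnegrE ?addr_ge0 ?nrm_ge0// sqr_nrm nrm2D sqrrD.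
rewrite !sqr_nrm [leRHS]addrAC lerD2l lerMn2r/=.
exact: le_trans (ler_norm _) (le_trans (Re_le_normc _) (cauchy_schwarz _ _)).
Qed.

Lemma nrm_sub_le x y : nrm x - nrm y <= nrm (x - y).
Proof. by rewrite lerBlDr (le_trans _ (nrmD _ _))// subrK. Qed.

Lemma nrm_sum (I : Type) (r : seq I) (P : pred I) (F : I -> H) :
  nrm (\sum_(i <- r | P i) F i) <= \sum_(i <- r | P i) nrm (F i).
Proof.
elim/big_rec2 : _ => [|i y1 y2 _ h]; first by rewrite nrm0.
by rewrite (le_trans (nrmD _ _))// lerD2l.
Qed.

Lemma nrm_sqr_inner x : (nrm x ^+ 2)%:C = inner x x.
Proof. by rewrite sqr_nrm inner_self. Qed.

Lemma inner_inj x y : (forall z, inner x z = inner y z) -> x = y.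
Proof.
move=> h; apply/eqP; rewrite -subr_eq0 -nrm_eq0 -sqrf_eq0; apply/eqP.
by apply: complexI; rewrite nrm_sqr_inner innerBl h subrr.
Qed.

End InnerProduct.

Arguments inner {R} xi eta : simpl never.
Arguments normc {R} x : simpl never.

(** * Weighted norms *)

Section WeightedNorms.
Variable R : realType.
Implicit Types (k l : int) (xi eta : nat -> R[i]).

Lemma wnorm_ge0 k xi : (0 <= wnorm k xi)%E. Proof. exact: sqrte_ge0. Qed.

Lemma wnorm_finE k xi : (wnorm k xi < +oo)%E -> wnorm k xi = (fine (wnorm k xi))%:E.
Proof. by move=> h; rewrite fineK// ge0_fin_numE// wnorm_ge0. Qed.

(** Multiplication by the weight is an isometry from the norm of order [k] to the [l_2] norm; the
    triangle inequality, duality and interpolation for weighted norms are transferred from [l_2]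
    along it. *)
Definition weight k xi : nat -> R[i] := fun j => ((j.+1%:R : R) ^ k)%:C * xi j.

Lemma wgt_gt0 k j : 0 < (j.+1%:R : R) ^ k.
Proof. by rewrite exprz_gt0// ltr0n. Qed.

Lemma normc_weight k xi j : normc (weight k xi j) = (j.+1%:R : R) ^ k * normc (xi j).
Proof. by rewrite normcM normc_real gtr0_norm// wgt_gt0. Qed.

Lemma wsum_weight k xi : wsum 0 (weight k xi) = wsum k xi.
Proof.
rewrite wsum0E; apply: eq_eseriesr => j _; congr (_%:E).
by rewrite normc_weight exprMn mulrC [(2 * k)%R]mulrC -exprz_exp.
Qed.

Lemma wnorm_weight k xi : wnorm 0 (weight k xi) = wnorm k xi.
Proof. by rewrite /wnorm wsum_weight. Qed.

Lemma weight_l2 k xi : (wnorm k xi < +oo)%E ->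
  exists2 x : l2_space R, x = weight k xi :> (nat -> R[i])
                        & wnorm k xi = (nrm x)%:E.
Proof.
move=> h; have h2 : weight k xi \in @in_l2 R by apply/asboolP; rewrite wnorm_weight.
by exists (L2Space h2) => //; rewrite -wnorm0E wnorm_weight.
Qed.

Lemma wnorm_le_coord (c : R) k l xi eta : 0 <= c ->
  (forall j, normc (xi j) * (j.+1%:R : R) ^ k <=
             c * (normc (eta j) * (j.+1%:R : R) ^ l)) ->
  (wnorm k xi <= c%:E * wnorm l eta)%E.
Proof.
move=> c0 h.
rewrite (_ : c%:E = sqrte (c ^+ 2)%:E); last by rewrite /= sqrtr_sqr ger0_norm.
rewrite /wnorm -sqrteM ?lee_fin ?sqr_ge0// lee_sqrt; last first.
  by rewrite mule_ge0 ?wsum_ge0// lee_fin sqr_ge0.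
rewrite -(wsum_weight k) -(wsum_weight l) !wsum0E -nneseriesZl; last first.
  by move=> j _; rewrite lee_fin sqr_ge0.
apply: lee_nneseries => [j _ _|j _]; first by rewrite lee_fin sqr_ge0.
rewrite -EFinM lee_fin -exprMn ler_pXn2r// ?nnegrE ?mulr_ge0 ?normc_ge0//.
by rewrite !normc_weight mulrC [X in _ <= _ * X]mulrC.
Qed.

Lemma wnorm_le_mono k l xi : k <= l -> (wnorm k xi <= wnorm l xi)%E.
Proof.
move=> kl; rewrite -[leRHS]mul1e; apply: wnorm_le_coord => // j.
by rewrite mul1r ler_wpM2l ?normc_ge0// ler_weXz2l// ler1n.
Qed.

Lemma wnormZ k (a : R[i]) xi : wnorm k (a *: xi) = ((normc a)%:E * wnorm k xi)%E.
Proof.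
apply/eqP; rewrite eq_le; apply/andP; split.
  apply: wnorm_le_coord => [|j]; first exact: normc_ge0.
  by rewrite -[(a *: xi) j]/(a * xi j) normcM mulrA.
have [->|a0] := eqVneq a 0; first by rewrite normc0 mul0e wnorm_ge0.
have na : 0 < normc a by rewrite normc_gt0.
rewrite muleC -lee_pdivlMr// muleC; apply: wnorm_le_coord => [|j].
  by rewrite invr_ge0 normc_ge0.
by rewrite -[(a *: xi) j]/(a * xi j) normcM -(mulrA (normc a)) mulKf ?gt_eqF.
Qed.

Lemma wnormN k xi : wnorm k (- xi) = wnorm k xi.
Proof. by rewrite -scaleN1r wnormZ normcN normc1 mul1e. Qed.

Lemma wnormD k xi eta : (wnorm k (xi + eta)%R <= wnorm k xi + wnorm k eta)%E.
Proof.
have [h1|] := ltP (wnorm k xi) +oo%E; last first.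
  by rewrite leye_eq => /eqP ->; rewrite addye ?leey// gt_eqF// (lt_le_trans _ (wnorm_ge0 _ _)).
have [h2|] := ltP (wnorm k eta) +oo%E; last first.
  by rewrite leye_eq => /eqP ->; rewrite addey ?leey// gt_eqF// (lt_le_trans _ (wnorm_ge0 _ _)).
have [x xE ->] := weight_l2 h1; have [y yE ->] := weight_l2 h2.
rewrite -wnorm_weight (_ : weight k _ = (x + y : l2_space R)).
  by rewrite wnorm0E lee_fin nrmD.
by apply/funext => j; rewrite l2_addE xE yE /weight mulrDr.
Qed.

Lemma wnorm_eq0 k xi : wnorm k xi = 0%E -> xi = 0.
Proof.
move=> h; have [|x xE] := @weight_l2 k xi; first by rewrite h ltry.
rewrite h => -[/esym/eqP]; rewrite nrm_eq0 => /eqP x0.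
apply/funext => j; have := congr1 (fun f => f j) xE; rewrite x0 => /esym/eqP.
rewrite mulf_eq0 => /orP[|/eqP//] /eqP /(congr1 (@complex.Re R))/= /eqP.
by rewrite gt_eqF ?wgt_gt0.
Qed.

Lemma wnorm_gt0 k xi : (0 < wnorm k xi)%E = (xi != 0).
Proof.
rewrite lt_def wnorm_ge0 andbT; congr (~~ _).
by apply/eqP/eqP => [/wnorm_eq0//|->]; rewrite wnorm0.
Qed.

Definition trunc (N : nat) xi : nat -> R[i] := fun j => if (j < N)%N then xi j else 0.

Lemma trunc_fin N k xi : (wnorm k (trunc N xi) < +oo)%E.
Proof.
rewrite wnorm_lty /wsum (nneseries_split _ N); last first.
  by move=> j _; rewrite lee_fin wterm_ge0.
rewrite add0n [X in (_ + X)%E]eseries0 ?adde0; last first.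
  move=> j Nj _; rewrite /trunc ifN -?leqNgt// normc0.
  by rewrite expr0n mul0r.
by rewrite sumEFin ltry.
Qed.

Lemma trunc_in_s N xi : trunc N xi \in @in_s R.
Proof. by apply/asboolP => q; exact: trunc_fin. Qed.

Lemma wnorm_trunc N k xi : (wnorm k (trunc N xi) <= wnorm k xi)%E.
Proof.
rewrite -[leRHS]mul1e; apply: wnorm_le_coord => // j; rewrite mul1r /trunc.
by case: ifP => // _; rewrite normc0 mul0r mulr_ge0 ?normc_ge0// ltW ?wgt_gt0.
Qed.

Lemma wnorm_trunc_weight N (q : nat) xi :
  (wnorm q (trunc N xi) <= ((N.+1%:R : R) ^+ q)%:E * wnorm 0 xi)%E.
Proof.
apply: wnorm_le_coord => [|j]; first by rewrite exprn_ge0.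
rewrite expr0z mulr1 /trunc; case: ifP => jN; last first.
  by rewrite normc0 mul0r mulr_ge0 ?normc_ge0// exprn_ge0.
by rewrite mulrC ler_wpM2r ?normc_ge0// lerXn2r ?nnegrE ?ler0n// ler_nat ltnS ltnW.
Qed.

(** Beyond the first [N] coordinates the base of the weight is at least [N.+1], so giving up [q]
    orders gains [N.+1 ^- q]. The order may be negative: [k = -1], [q = 1] yields compactness on
    [l_2], while [k = 0] concentrates eigenvectors on few coordinates. *)
Lemma wnorm_tail (N : nat) k (q : nat) xi :
  (wnorm k (xi - trunc N xi)%R <= (((N.+1%:R : R) ^+ q)^-1)%:E * wnorm (k + q)%R xi)%E.
Proof.
have N0 : 0 < (N.+1%:R : R) ^+ q by rewrite exprn_gt0.
apply: wnorm_le_coord => [|j]; first by rewrite invr_ge0 ltW.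
rewrite [X in normc X](_ : _ = if (j < N)%N then 0 else xi j); last first.
  rewrite -[LHS]/(xi j - trunc N xi j) /trunc.
  by case: ifP => _; rewrite ?subrr ?subr0.
have jk := wgt_gt0 k j.
rewrite expfzDr ?pnatr_eq0// mulrCA mulrA.
case: ifP => jN.
  by rewrite normc0 mul0r !mulr_ge0 ?normc_ge0 ?ltW ?invr_gt0// exprn_gt0.
have ring4 (a b c d : R) : a * b * (c * d) = a * c * (d * b) by ring.
rewrite ring4.
rewrite -[leLHS]mulr1 ler_wpM2l//; first by rewrite mulr_ge0 ?normc_ge0// ltW.
rewrite ler_pdivlMr// mul1r lerXn2r ?nnegrE ?ler0n// ler_nat ltnS.
by rewrite leqNgt jN.
Qed.

(** A Fatou property. It allows estimates on finitely many coordinates, where all weighted norms are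
    comparable with the [l_2] norm. *)
Lemma wnorm_le_trunc k xi (C : R) : 0 <= C ->
  (forall N, (wnorm k (trunc N xi) <= C%:E)%E) -> (wnorm k xi <= C%:E)%E.
Proof.
move=> C0 h.
have h2 n : \sum_(0 <= j < n) normc (weight k xi j) ^+ 2 <= C ^+ 2.
  have := h n; have [x xE ->] := weight_l2 (trunc_fin n k xi).
  rewrite lee_fin => xC; apply: (@le_trans _ _ (nrm x ^+ 2)); last first.
    by rewrite lerXn2r ?nnegrE ?nrm_ge0.
  rewrite sqr_nrm; apply: le_trans (sum_nrm2_le x n).
  rewrite !big_nat; apply: ler_sum => j /= jn.
  by rewrite xE /weight /trunc jn.
have [x xE xC] := nrm2_leP h2.
rewrite -wnorm_weight -xE wnorm0E lee_fin -(@ler_pXn2r _ 2)// ?nnegrE ?nrm_ge0//.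
by rewrite sqr_nrm.
Qed.

Lemma wnorm_tail_small k xi (e : R) : (wnorm k xi < +oo)%E -> 0 < e ->
  exists N, (wnorm k (xi - trunc N xi)%R < e%:E)%E.
Proof.
move=> h e0; have [x xE _] := weight_l2 h.
(* Half of [e ^+ 2], because the convergence is used with a large inequality and the conclusion is
   strict. *)
have c := @l2_cvg R x; have e2 : 0 < e ^+ 2 / 2 by rewrite divr_gt0 ?exprn_gt0.
have /cvgrPdist_le /(_ _ e2) [N _ hN] := c; exists N.
apply: (@le_lt_trans _ _ (Num.sqrt (e ^+ 2 / 2))%:E); last first.
  rewrite lte_fin -(@ltr_pXn2r _ 2)// ?nnegrE ?sqrtr_ge0 ?ltW//.
  rewrite sqr_sqrtr ?ltW// ltr_pdivrMr//; lra.
rewrite -wnorm_weight.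
have h2 n : \sum_(0 <= j < n) normc (weight k (xi - trunc N xi) j) ^+ 2 <= e ^+ 2 / 2.
  have hw j : normc (weight k (xi - trunc N xi) j) ^+ 2 =
      if (j < N)%N then 0 else normc (x j) ^+ 2.
    rewrite xE /weight -[(xi - _) j]/(xi j - trunc N xi j) /trunc.
    by case: ifP => _; rewrite ?subrr ?subr0// mulr0 normc0 expr0n.
  rewrite (eq_bigr _ (fun j _ => hw j)).
  have [nN|Nn] := leqP n N.
    rewrite big_nat big1 ?ltW// => j /= jn.
    by rewrite (leq_trans jn nN).
  rewrite (@big_cat_nat _ _ _ N)//=; last exact: ltnW.
  rewrite [X in X + _]big_nat [X in X + _]big1 ?add0r; last by move=> j /= ->.
  have := hN N (leqnn N); rewrite ger0_norm ?subr_ge0 ?sum_nrm2_le// lerBlDl.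
  move/(le_trans (sum_nrm2_le x n)).
  rewrite {1}(@big_cat_nat _ _ _ N)//=; last exact: ltnW.
  rewrite -/(series _ N) lerD2l; apply: le_trans.
  rewrite !big_nat; apply: ler_sum => j /= /andP[Nj _].
  by rewrite ltnNge Nj.
have [y yE yC] := nrm2_leP h2.
rewrite -yE wnorm0E lee_fin -(@ler_pXn2r _ 2)// ?nnegrE ?nrm_ge0 ?sqrtr_ge0//.
by rewrite sqr_nrm sqr_sqrtr// ltW.
Qed.

(** The weights of opposite orders cancel in each term of the inner product. *)
Lemma weighted_cauchy_schwarz k (x y : l2_space R) : (wnorm k x < +oo)%E ->
  (wnorm (- k) y < +oo)%E ->
  ((normc (inner x y))%:E <= wnorm k x * wnorm (- k) y)%E.
Proof.
move=> hx hy; have [u uE ->] := weight_l2 hx; have [v vE ->] := weight_l2 hy.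
have <- : inner u v = inner x y.
  have uv j : u j * conjc (v j) = x j * conjc (y j).
    rewrite uE vE /weight conjcM conjc_real mulrACA -rmorphM.
    by rewrite -expfzDr ?pnatr_eq0// subrr expr0z mul1r.
  by rewrite /inner; congr (limn (series _) +i* limn (series _)); apply/funext => j; rewrite uv.
by rewrite -EFinM lee_fin cauchy_schwarz.
Qed.

(** Cauchy-Schwarz between [xi] and its weighted copy of order 2q: the weight of |xi_j|^2 in the
    square of the norm of order q is put on one factor only. *)
Lemma wnorm_interpolation (q : nat) (xi : nat -> R[i]) :
  (wnorm (2 * q)%N xi < +oo)%E ->
  (wnorm q xi ^+ 2 <= wnorm 0 xi * wnorm (2 * q)%N xi)%E.
Proof.
move=> h.
have hq : (wnorm q xi < +oo)%E.
  by apply: le_lt_trans h; apply: wnorm_le_mono; rewrite lez_nat leq_pmull.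
have h0 : (wnorm 0 xi < +oo)%E.
  by apply: le_lt_trans h; apply: wnorm_le_mono.
have [u uE ->] := weight_l2 hq; have [v vE ->] := weight_l2 h.
have [x xE ->] := weight_l2 h0.
rewrite -EFinM -EFin_expe lee_fin.
have := cauchy_schwarz x v; suff -> : inner x v = inner u u.
  by rewrite -nrm_sqr_inner normc_real ger0_norm ?sqr_ge0.
have xv j : x j * conjc (v j) = u j * conjc (u j).
  rewrite xE uE vE /weight !conjcM !conjc_real [LHS]mulrACA [RHS]mulrACA -!rmorphM.
  by rewrite -!expfzDr ?pnatr_eq0// add0r mul2n -addnn PoszD.
by rewrite /inner; congr (limn (series _) +i* limn (series _)); apply/funext => j; rewrite xv.
Qed.

End WeightedNorms.

(** * Continuity of operators from s' to s as norm estimates *)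

Section SmoothOperators.
Variable R : realType.
Local Notation H := (l2_space R).
Implicit Types (x : smooth_op R) (xi eta : sdual_space R) (u v : H).

Lemma wnorm_s_fin (k : int) (v : s_space R) : (wnorm k v < +oo)%E.
Proof.
have /asboolP/(_ `|k|%N) := s_valP v; apply: wnorm_mono.
by rewrite abszE ler_norm.
Qed.

Lemma wnorm_l2_fin (q : nat) u : (wnorm (- q%:Z) u < +oo)%E.
Proof. by have /asboolP := l2_valP u; apply: wnorm_mono; rewrite oppr_le0. Qed.

Definition strunc N (xi : nat -> R[i]) : s_space R := SSpace (trunc_in_s N xi).

Lemma s_to_l2_sum (I : Type) (r : seq I) (P : pred I) (F : I -> s_space R) :
  s_to_l2 (\sum_(i <- r | P i) F i) = \sum_(i <- r | P i) s_to_l2 (F i).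
Proof. by elim/big_rec2 : _ => [|i y1 y2 _ <-]; exact: val_inj. Qed.

(** The preimage of the unit ball of |.|_q contains a 0-neighbourhood of the inductive limit, hence
    a ball for each |.|'_p; homogeneity does the rest. The bound is trivial where |xi|'_p is
    infinite. *)
Lemma smooth_bound x (q p : nat) : exists2 C : R, 0 < C &
  forall xi, (wnorm q (x xi) <= C%:E * wnorm (- p%:Z) xi)%E.
Proof.
pose O : set (s_space R) := [set v | (wnorm q v < 1)%E].
have oO : open O.
  move=> v Ov; have vf := wnorm_finE (wnorm_s_fin q v).
  have v1 : fine (wnorm q v) < 1 by rewrite -lte_fin -vf.
  exists q, (1 - fine (wnorm q v)); split; first by rewrite subr_gt0.
  move=> w /(_ q (leqnn q)) h; rewrite /O /=.
  rewrite -(_ : (w - v)%R + v = w :> s_space R); last by rewrite subrK.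
  apply: le_lt_trans (wnormD _ _ _) _.
  move: h; rewrite vf; have -> := wnorm_finE (wnorm_s_fin q (w - v)).
  by rewrite -EFinD !lte_fin ltrBrDr.
have := (continuousP _).1 (@smooth_continuous R x) _ oO.
have O0 : O (x 0) by rewrite /O /= linear0 wnorm0 lte_fin.
move=> /(_ _ O0) [U [_ /(_ p)[e e0 eU]] UO].
have xe xi : (wnorm (- p%:Z) xi < e%:E)%E -> (wnorm q (x xi) < 1)%E.
  by move=> /eU/UO; rewrite /O /= add0r.
(* The 2 comes from rescaling [xi] to norm [e / 2], strictly inside the ball of radius [e]. *)
exists (2 / e) => [|xi]; first by rewrite divr_gt0.
have [h|] := ltP (wnorm (- p%:Z) xi) +oo%E; last first.
  by rewrite leye_eq => /eqP ->; rewrite mulry gtr0_sg ?divr_gt0// mul1e leey.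
have [xi0|] := eqVneq (sdual_val xi) 0.
  have -> : xi = 0 by apply: val_inj.
  by rewrite linear0 [leLHS]wnorm0 mule_ge0 ?wnorm_ge0// lee_fin divr_ge0// ltW.
rewrite -(wnorm_gt0 (- p%:Z)) (wnorm_finE h) lte_fin.
set r := fine _ => r0.
have t0 : 0 < e / (2 * r) by rewrite divr_gt0// mulr_gt0.
have := xe ((e / (2 * r))%:C *: xi).
rewrite linearZ /= (wnormZ (- p%:Z)) (wnormZ q) normc_real gtr0_norm// (wnorm_finE h) -/r.
rewrite (wnorm_finE (wnorm_s_fin q (x xi))) -!EFinM !lte_fin lee_fin => /(_ _).
rewrite (_ : e / (2 * r) * r = e / 2); last by field; rewrite gt_eqF.
rewrite ltr_pdivrMr// mulr_natr mulr2n ltrDl => /(_ e0) h2.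
rewrite (_ : 2 / e * r = 1 / (e / (2 * r))); last first.
  by field; rewrite !gt_eqF.
by rewrite ler_pdivlMr// mulrC ltW.
Qed.

Lemma bounded_smooth (f : {linear sdual_space R -> s_space R}) :
  (forall q p : nat, exists2 C : R, 0 < C &
     forall xi, (wnorm q (f xi) <= C%:E * wnorm (- p%:Z) xi)%E) ->
  continuous f.
Proof.
move=> fb; apply/continuousP => A oA; suff : open_sdual (f @^-1` A) by [].
move=> xi Axi; have [q [e [e0 eA]]] := (oA : open_s A) _ Axi.
(* This preimage of a ball is itself a basic neighbourhood: it is absolutely convex, and the bound
   for each [p] puts a ball of radius [e / C] into its trace. *)
exists [set eta | (wnorm q (f eta) < e%:E)%E]; last first.
  move=> eta /= h; apply: eA => p pq; rewrite linearD addrC addKr.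
  by apply: le_lt_trans h; apply: wnorm_le_mono; rewrite lez_nat.
split=> [a b x y ab /= Ux Uy|p]; last first.
  have [C C0 fC] := fb q p; exists (e / C) => [|eta h]; first by rewrite divr_gt0.
  apply: le_lt_trans (fC eta) _.
  by rewrite muleC -lte_pdivlMr.
rewrite linearD !linearZ /=; apply: le_lt_trans (wnormD _ _ _) _.
rewrite !wnormZ; move: Ux Uy.
rewrite (wnorm_finE (wnorm_s_fin q (f x))) (wnorm_finE (wnorm_s_fin q (f y))).
rewrite -!EFinM -EFinD !lte_fin; set X := fine _; set Y := fine _ => Xe Ye.
apply: (@le_lt_trans _ _ (Num.max X Y)); last by rewrite gt_max Xe.
have XY0 : 0 <= Num.max X Y by rewrite le_max /X fine_ge0 ?wnorm_ge0.
apply: (@le_trans _ _ ((normc a + normc b) * Num.max X Y)); last by rewrite ler_piMl.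
by rewrite mulrDl lerD// ler_wpM2l ?normc_ge0// le_max lexx ?orbT.
Qed.

(** An argument in the unit ball of |.|'_q is split into a truncation, which is in [l_2] and stays
    in the ball, and an arbitrarily small tail. The bound [B] serves only to make the image of the
    tail small, so its size does not enter the conclusion. *)
Lemma opnorm_le_l2 (q : nat) (f : sdual_space R -> s_space R) (B C : R) :
  {morph f : xi eta / xi + eta} -> 0 < B -> 0 <= C ->
  (forall xi, (wnorm q (f xi) <= B%:E * wnorm (- q%:Z) xi)%E) ->
  (forall u : H, (wnorm (- q%:Z) u <= 1)%E ->
     (wnorm q (f (l2_to_sdual u)) <= C%:E)%E) ->
  (opnorm q f <= C%:E)%E.
Proof.
move=> fD B0 C0 fB fC; apply: ge_ereal_sup => _ [xi xi1 <-].
apply/lee_addgt0Pr => e e0.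
have xif : (wnorm (- q%:Z) xi < +oo)%E by apply: le_lt_trans xi1 _; rewrite ltry.
have [N hN] := wnorm_tail_small xif (divr_gt0 e0 B0).
pose t := l2_to_sdual (s_to_l2 (strunc N xi)).
rewrite (_ : xi = t + (xi - t)); last by rewrite addrC subrK.
rewrite fD; apply: le_trans (wnormD _ _ _) _; apply: leeD.
  by apply: fC; apply: le_trans xi1; exact: wnorm_trunc.
by apply: le_trans (fB _) _; rewrite muleC -lee_pdivlMr// ltW.
Qed.

Lemma opnorm_boundE (q : nat) (f : sdual_space R -> s_space R) (C : R) xi :
  (forall a eta, f (a *: eta) = a *: f eta) -> (opnorm q f <= C%:E)%E -> 0 <= C ->
  (wnorm (- q%:Z) xi < +oo)%E ->
  (wnorm q (f xi) <= C%:E * wnorm (- q%:Z) xi)%E.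
Proof.
move=> fZ fC C0 h; have [xi0|] := eqVneq (sdual_val xi) 0.
  have -> : xi = 0 by apply: val_inj.
  by rewrite -(scale0r (0 : sdual_space R)) fZ scale0r [leLHS]wnorm0 mule_ge0// wnorm_ge0.
rewrite -(wnorm_gt0 (- q%:Z)) (wnorm_finE h) lte_fin; set r := fine _ => r0.
rewrite -lee_pdivrMr// muleC.
rewrite -[X in (X%:E * _)%E](@gtr0_norm _ r^-1) ?invr_gt0// -normc_real.
rewrite -wnormZ -[X in wnorm q X]/(s_val (_ *: f xi)) -fZ.
apply: le_trans fC; apply: ereal_sup_ubound.
eexists; last reflexivity; rewrite /= wnormZ normc_real gtr0_norm ?invr_gt0//.
by rewrite (wnorm_finE h) -/r -EFinM mulVf// gt_eqF.
Qed.

Lemma opnorm_ge0 (q : nat) (f : sdual_space R -> s_space R) : (0 <= opnorm q f)%E.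
Proof.
apply: le_trans (wnorm_ge0 q (f 0)) _; apply: ereal_sup_ubound.
by exists 0 => //=; rewrite wnorm0.
Qed.

Lemma opnormZ (q : nat) (f : sdual_space R -> s_space R) (a : R[i]) (C : R) :
  (opnorm q f <= C%:E)%E ->
  (opnorm q (fun xi => a *: f xi) <= (normc a * C)%:E)%E.
Proof.
move=> fC; apply: ge_ereal_sup => _ [xi xi1 <-].
rewrite wnormZ EFinM; apply: lee_wpmul2l; first by rewrite lee_fin normc_ge0.
by apply: le_trans fC; apply: ereal_sup_ubound; exists xi.
Qed.

Lemma opnorm_fin (q : nat) x : exists2 C : R, 0 < C & (opnorm q x <= C%:E)%E.
Proof.
have [C C0 xC] := smooth_bound x q q; exists C => //.
apply: ge_ereal_sup => _ [xi xi1 <-]; apply: le_trans (xC xi) _.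
by rewrite -[leRHS]mule1 lee_wpmul2l// lee_fin ltW.
Qed.

Lemma restr_linear x : linear (restr_l2 x).
Proof.
move=> a u v; apply: l2P => j.
have -> : restr_l2 x (a *: u + v) = s_to_l2 (x (a *: l2_to_sdual u + l2_to_sdual v)).
  by congr (s_to_l2 (x _)); apply: val_inj.
by rewrite linearP.
Qed.

Lemma restr_bound x (q : nat) : exists2 C : R, 0 < C &
  forall u, (wnorm q (restr_l2 x u) <= (C * nrm u)%:E)%E.
Proof.
have [C C0 h] := smooth_bound x q 0; exists C => // u.
by rewrite EFinM -wnorm0E; exact: (h (l2_to_sdual u)).
Qed.

(** Each [xi] is the limit of its truncations in some norm |.|'_q, and both operators are bounded
    for that norm. *)
Lemma restr_ext x y : restr_l2 x =1 restr_l2 y -> x =1 y.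
Proof.
move=> xy xi; apply: val_inj.
have /asboolP[q xiq] := sdual_valP xi.
have [B B0 xB] := smooth_bound x 0 q; have [C C0 yC] := smooth_bound y 0 q.
apply/eqP; rewrite -subr_eq0; apply/eqP/(@wnorm_eq0 _ 0).
apply/eqP; rewrite eq_le wnorm_ge0 andbT; apply/lee_addgt0Pr => e e0; rewrite add0e.
have BC : 0 < B + C by rewrite addr_gt0.
have [N hN] := wnorm_tail_small xiq (divr_gt0 e0 BC).
pose t := s_to_l2 (strunc N xi).
have xyD a b : x a = y a -> s_val (x (a + b)) - s_val (y (a + b)) = s_val (x b) - s_val (y b).
  move=> ab; rewrite -[LHS]/(s_val (x (a + b) - y (a + b))) (linearD x) (linearD y) ab.
  by rewrite opprD addrACA subrr add0r.
rewrite (_ : xi = l2_to_sdual t + (xi - l2_to_sdual t)); last by rewrite addrC subrK.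
rewrite xyD; last by apply: val_inj; exact: (congr1 (@l2_val R) (xy t)).
apply: le_trans (wnormD _ _ _) _; rewrite wnormN.
apply: le_trans (leeD (xB _) (yC _)) _.
rewrite -ge0_muleDl ?lee_fin ?(ltW B0) ?(ltW C0)//.
by rewrite -EFinD muleC -lee_pdivlMr// ltW.
Qed.

End SmoothOperators.

(** * Compact self-adjoint operators *)

Section WeakCompactness.
Variable R : realType.
Local Notation H := (l2_space R).
Implicit Types (u v w : H) (T : H -> H).

Definition truncl2 N u : H := s_to_l2 (strunc N u).
Definition unitv (n : nat) : H := s_to_l2 (strunc n.+1 (fun j => (j == n)%:R)).

Arguments truncl2 : simpl never.
Arguments unitv : simpl never.

Lemma unitvE n j : unitv n j = (j == n)%:R.
Proof.
by rewrite /unitv/= /trunc; case: ltnP => // nj; rewrite gtn_eqF.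
Qed.

Lemma inner_unitv u n : inner u (unitv n) = u n.
Proof.
have h (f : R[i] -> R) : f 0 = 0 ->
    limn (series (fun j => f (u j * conjc (unitv n j)))) = f (u n).
  move=> f0; apply: lim_near_cst => //; exists n.+1 => // m /= nm.
  rewrite /series /= (big_cat_nat _ (n := n.+1))//= big_nat_recr//=.
  rewrite big_nat big1 ?add0r; last first.
    move=> j /= jn; rewrite -[trunc _ _ _]/(unitv n j) unitvE ltn_eqF// conjc0.
    by rewrite mulr0.
  rewrite big_nat big1 ?addr0; last first.
    move=> j /= /andP[nj _]; rewrite -[trunc _ _ _]/(unitv n j) unitvE gtn_eqF//.
    by rewrite conjc0 mulr0.
  by rewrite -[trunc _ _ _]/(unitv n n) unitvE eqxx conjc1 mulr1.
by rewrite /inner !h//; case: (u n).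
Qed.

Lemma nrm_unitv n : nrm (unitv n) = 1.
Proof.
apply/eqP; rewrite -(@eqrXn2 _ 2)// ?nrm_ge0// expr1n; apply/eqP/complexI.
by rewrite nrm_sqr_inner inner_unitv unitvE eqxx.
Qed.

Lemma truncl2E N u j : truncl2 N u j = if (j < N)%N then u j else 0.
Proof. by []. Qed.

Lemma nrm_truncl2 N u : nrm (truncl2 N u) <= nrm u.
Proof. by rewrite -lee_fin -!wnorm0E wnorm_trunc. Qed.

Lemma nrm_tail_small u (e : R) : 0 < e -> exists N, nrm (u - truncl2 N u) < e.
Proof.
move=> e0; have [|N hN] := @wnorm_tail_small R 0 u e _ e0.
  by rewrite wnorm0E ltry.
by exists N; rewrite -lte_fin -wnorm0E.
Qed.

(** A crude bound, used to turn smallness of finitely many coordinates into smallness of the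
    norm. *)
Lemma nrm_finite_supp N u : (forall j, (N <= j)%N -> u j = 0) ->
  nrm u <= \sum_(0 <= j < N) normc (u j).
Proof.
move=> u0; rewrite {1}(_ : u = \sum_(0 <= j < N) u j *: unitv j).
  apply: le_trans (nrm_sum _ _ _) _; apply: ler_sum => j _.
  by rewrite nrmZ nrm_unitv mulr1.
apply: l2P => j; rewrite l2_val_sum; have [jN|Nj] := ltnP j N.
  rewrite (bigD1_seq j) ?iota_uniq ?mem_index_iota//=.
  rewrite -[X in X + _]/(u j * unitv j j) unitvE eqxx mulr1.
  rewrite big1 ?addr0// => i /negPf ij.
  by rewrite -[LHS]/(u i * unitv i j) unitvE eq_sym ij mulr0.
rewrite u0// big_nat big1// => i /andP[_ iN].
by rewrite -[LHS]/(u i * unitv i j) unitvE gtn_eqF ?mulr0// (leq_trans iN).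
Qed.

(** Compactness of [-M, M] gives a cluster point of the image, and an ultrafilter converges to its
    cluster points. *)
Lemma ultra_real_limit (X : Type) (U : set_system X) (f : X -> R) (M : R) :
  UltraFilter U -> U [set a | `|f a| <= M] ->
  exists r : R, forall e : R, 0 < e -> U [set a | `|f a - r| < e].
Proof.
move=> UU UM; have UI : (f @ U) `[- M, M]%classic.
  suff : U (f @^-1` `[- M, M]%classic) by [].
  by apply: filterS UM => a; rewrite /= in_itv /= -ler_norml.
have [r [_ rU]] := @segment_compact R (- M) M (f @ U) _ UI.
exists r => e e0; case: (in_ultra_setVsetC [set a | `|f a - r| < e] UU) => // Uc.
have := rU [set y | ~ (`|y - r| < e)] (ball r e) Uc (nbhsx_ballx r e e0).
by move=> -[y [/= hy]]; rewrite /ball /= distrC.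
Qed.

(** Weak compactness of the unit ball, with an ultrafilter in place of subsequences: the coordinates
    converge one by one, and the norm bound survives on every finite block of coordinates. *)
Lemma weak_limit (U : set_system H) : UltraFilter U -> U [set u | nrm u <= 1] ->
  exists2 v, nrm v <= 1 &
    forall (n : nat) (e : R), 0 < e ->
      U [set u | forall j, (j < n)%N -> normc (u j - v j) < e].
Proof.
move=> UU U1.
have hre j : exists r : R, forall e : R, 0 < e -> U [set u | `|complex.Re (u j) - r| < e].
  apply: (@ultra_real_limit _ _ _ 1) => //; apply: filterS U1 => u /= u1.
  by rewrite (le_trans (Re_le_normc _))// (le_trans (normc_coord _ _)).
have him j : exists r : R, forall e : R, 0 < e -> U [set u | `|complex.Im (u j) - r| < e].
  apply: (@ultra_real_limit _ _ _ 1) => //; apply: filterS U1 => u /= u1.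
  by rewrite (le_trans (Im_le_normc _))// (le_trans (normc_coord _ _)).
have [a ha] := choice hre; have [b hb] := choice him.
pose v0 j := a j +i* b j.
have hv (n : nat) (e : R) : 0 < e ->
    U [set u | forall j, (j < n)%N -> normc (u j - v0 j) < e].
  move=> e0; elim: n => [|n IH]; first by apply: filterS U1 => u _ j.
  have e20 : 0 < e / 2 by rewrite divr_gt0.
  apply: filterS (filterI IH (filterI (ha n _ e20) (hb n _ e20))) => u /= [h [hr hi]] j.
  rewrite ltnS leq_eqVlt => /orP[/eqP ->|/h//].
  apply: le_lt_trans (normc_le _) _; rewrite [ltRHS]splitr.
  by move: hr hi; case: (u n) => p q /= hr hi; rewrite ltrD.
have h2 n : \sum_(0 <= j < n) normc (v0 j) ^+ 2 <= 1 ^+ 2.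
  pose w := s_to_l2 (strunc n v0).
  have wv j : (j < n)%N -> w j = v0 j by rewrite /= /trunc => ->.
  apply: (@le_trans _ _ (nrm w ^+ 2)); last first.
    rewrite lerXn2r ?nnegrE ?nrm_ge0//; apply/ler_addgt0Pr => e e0.
    (* Each of the [n] coordinates may be wrong by this much, for a total error of at most [e]; the
       successor covers [n = 0]. *)
    have en : 0 < e / n.+1%:R by rewrite divr_gt0.
    have [u [/= u1 hu]] := filter_ex (filterI U1 (hv n _ en)).
    rewrite -[w](subrK (truncl2 n u)) addrC.
    apply: le_trans (nrmD _ _) _; apply: lerD.
      exact: le_trans (nrm_truncl2 _ _) u1.
    apply: (@le_trans _ _ (\sum_(0 <= j < n) normc ((w - truncl2 n u) j))).
      apply: nrm_finite_supp => j nj; rewrite l2_subE truncl2E /= /trunc ltnNge nj/=.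
      by rewrite subrr.
    apply: (@le_trans _ _ (\sum_(0 <= j < n) e / n.+1%:R)).
      rewrite !big_nat; apply: ler_sum => j /andP[_ jn].
      by rewrite l2_subE truncl2E jn (wv j jn) normcB ltW// hu.
    rewrite sumr_const_nat subn0 -[leLHS]mulr_natr -mulrA mulrC ler_piMl ?(ltW e0)//.
    by rewrite mulrC ler_pdivrMr// mul1r ler_nat.
  rewrite sqr_nrm; apply: le_trans (sum_nrm2_le w n).
  by rewrite !big_nat; apply: ler_sum => j /= jn; rewrite -(wv j jn).
have [v vE v1] := nrm2_leP h2; exists v; last by move=> n e e0; rewrite vE; exact: hv.
by rewrite -(@ler_pXn2r _ 2)// ?nnegrE ?nrm_ge0// sqr_nrm.
Qed.

(* For p = |T .| with T linear and bounded, this says that T is compact. *)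
Definition tail_small (p : H -> R) := forall e, 0 < e ->
  exists N, forall u, (forall j, (j < N)%N -> u j = 0) -> p u <= e * nrm u.

Definition nrm_bounded (p : H -> R) := exists2 C, 0 < C & forall u, p u <= C * nrm u.

(** Compactness turns weak convergence into norm convergence: the tail of [u - v] is handled by
    [tail_small], the head by the coordinates. A general [p] covers both |A u| and |<u, s>|. *)
Lemma weak_limit_seminorm (U : set_system H) v (p : H -> R) : UltraFilter U ->
  U [set u | nrm u <= 1] -> nrm v <= 1 ->
  (forall (n : nat) (e : R), 0 < e ->
     U [set u | forall j, (j < n)%N -> normc (u j - v j) < e]) ->
  (forall u w, p (u + w) <= p u + p w) -> nrm_bounded p -> tail_small p ->
  forall e, 0 < e -> U [set u | p (u - v) < e].
Proof.
move=> UU U1 v1 Uv pD [C C0 pC] pt e e0.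
(* [u - v] has norm at most 2, so the tail contributes at most [e / 2], and the head at most
   [e / 4]. *)
have [|N hN] := pt (e / 4); first by rewrite divr_gt0.
have d0 : 0 < e / (4 * C * N.+1%:R) by rewrite divr_gt0// !mulr_gt0.
apply: filterS (filterI U1 (Uv N _ d0)) => u /= [u1 hu].
set d := u - v; rewrite -(subrK (truncl2 N d) d).
apply: le_lt_trans (pD _ _) _.
have d2 : nrm d <= 2 by rewrite (le_trans (nrmD _ _))// nrmN; lra.
have dt2 : nrm (d - truncl2 N d) <= nrm d.
  rewrite -lee_fin -!wnorm0E; apply: le_trans (wnorm_tail N 0 0 _) _.
  by rewrite expr0 invr1 mul1e.
have h1 : p (d - truncl2 N d) <= e / 2.
  apply: le_trans (hN _ _) _ => [j jN|].
    by rewrite l2_subE truncl2E jN subrr.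
  rewrite (_ : e / 2 = e / 4 * 2); last by field.
  by rewrite ler_pM2l ?divr_gt0// (le_trans dt2).
have h2 : p (truncl2 N d) <= e / 4.
  apply: le_trans (pC _) _; rewrite mulrC -ler_pdivlMr//.
  apply: (@le_trans _ _ (\sum_(0 <= j < N) normc (truncl2 N d j))).
    by apply: nrm_finite_supp => j Nj; rewrite truncl2E ltnNge Nj.
  apply: (@le_trans _ _ (\sum_(0 <= j < N) e / (4 * C * N.+1%:R))).
    rewrite !big_nat; apply: ler_sum => j /andP[_ jN].
    by rewrite truncl2E jN ltW// hu.
  rewrite sumr_const_nat subn0 -[leLHS]mulr_natr.
  rewrite (_ : _ * N%:R = e / 4 / C * (N%:R / N.+1%:R)); last first.
    by rewrite !invfM; ring.
  rewrite ler_piMr ?divr_ge0 ?(ltW e0) ?(ltW C0)//.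
  by rewrite ler_pdivrMr// mul1r ler_nat.
by apply: le_lt_trans (lerD h1 h2) _; lra.
Qed.

Lemma inner_bounded w : nrm_bounded (fun u => normc (inner u w)).
Proof.
exists (nrm w + 1) => [|u]; first by rewrite ltr_wpDl ?nrm_ge0.
apply: le_trans (cauchy_schwarz _ _) _; rewrite mulrC ler_wpM2r ?nrm_ge0//.
by rewrite lerDl.
Qed.

(** Against a vector whose first coordinates vanish, only the tail of [w] counts. The purpose is to
    let orthogonality pass to weak limits. *)
Lemma inner_tail_small w : tail_small (fun u => normc (inner u w)).
Proof.
move=> e e0; have [N hN] := nrm_tail_small w e0; exists N => u u0.
rewrite (_ : inner u w = inner u (w - truncl2 N w)).
  by rewrite (le_trans (cauchy_schwarz _ _))// mulrC ler_wpM2r ?nrm_ge0// ltW.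
rewrite innerBr (_ : inner u (truncl2 N w) = 0) ?subr0//.
by apply: inner_coord0 => j; rewrite truncl2E; case: ifP => [/u0 ->|_];
   rewrite ?mul0r// conjc0 mulr0.
Qed.

(** Invariant subspaces enter the proof only as orthogonals of arbitrary sets, which are closed
    under weak limits by construction. *)
Definition orth (S : set H) u := forall s, S s -> inner u s = 0.

Lemma orth_lin S a u v : orth S u -> orth S v -> orth S (a *: u + v).
Proof. by move=> hu hv s Ss; rewrite innerDl innerZl hu// hv// mulr0 addr0. Qed.

Lemma linD T u v : linear T -> T (u + v) = T u + T v.
Proof. by move=> lT; have := lT 1 u v; rewrite !scale1r. Qed.

Lemma lin0 T : linear T -> T 0 = 0.
Proof. by move=> lT; have := lT (-1) 0 0; rewrite scaler0 addr0 scaleN1r addNr. Qed.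

Lemma linZ T a u : linear T -> T (a *: u) = a *: T u.
Proof. by move=> lT; have := lT a u 0; rewrite (lin0 lT) !addr0. Qed.

Lemma linN T u : linear T -> T (- u) = - T u.
Proof. by move=> lT; rewrite -scaleN1r linZ// scaleN1r. Qed.

Lemma linB T u v : linear T -> T (u - v) = T u - T v.
Proof. by move=> lT; rewrite linD// linN. Qed.

Lemma lin_sum T (I : Type) (r : seq I) (P : pred I) (F : I -> H) : linear T ->
  T (\sum_(i <- r | P i) F i) = \sum_(i <- r | P i) T (F i).
Proof.
by move=> lT; elim/big_rec2 : _ => [|i y1 y2 _ <-]; rewrite ?lin0// linD.
Qed.

Lemma nrm_lin_subadd T u v : linear T -> nrm (T (u + v)) <= nrm (T u) + nrm (T v).
Proof. by move=> lT; rewrite linD// nrmD. Qed.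

(* A maximizing sequence for |A u| on the unit ball of the orthogonal of S has a
   weak limit v which attains the maximum M, so that A (A v) = M^2 v; then
   either A v = - M v or A v + M v is an eigenvector. *)
Lemma selfadjoint_eigenvector (A : H -> H) (S : set H) :
  linear A -> is_adjoint A A ->
  nrm_bounded (fun u => nrm (A u)) -> tail_small (fun u => nrm (A u)) ->
  (forall u, orth S u -> orth S (A u)) ->
  exists2 alpha : R, (forall u, orth S u -> nrm (A u) <= `|alpha| * nrm u) &
    alpha = 0 \/ exists v, [/\ orth S v, v != 0 & A v = alpha%:C *: v].
Proof.
move=> lA sA [C C0 bA] tA AS.
have [A0|] := pselect (forall u, orth S u -> A u = 0).
  by exists 0; [move=> u /A0 ->; rewrite nrm0 normr0 mul0r|left].
move=> /existsNP[u0 /not_implyP[Su0 /eqP Au0]].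
pose B := [set u | orth S u /\ nrm u <= 1].
pose E := [set nrm (A u) | u in B].
have B0 : B 0 by split; [move=> s _; rewrite inner0l|rewrite nrm0].
have Esup : has_sup E.
  split; first by exists (nrm (A 0)), 0.
  exists C => _ [u [_ u1] <-]; apply: le_trans (bA u) _.
  by rewrite ler_piMr// ltW.
set M := sup E.
have Mub u : B u -> nrm (A u) <= M.
  by move=> Bu; apply: sup_upper_bound => //; exists u.
have scaleB u : orth S u -> u != 0 -> B ((nrm u)^-1%:C *: u).
  move=> Su u1; split.
    by have := @orth_lin S (nrm u)^-1%:C u 0 Su (B0.1); rewrite addr0.
  by rewrite nrmZ normc_real ger0_norm ?invr_ge0 ?nrm_ge0// mulVf ?nrm_eq0.
have MA u : orth S u -> nrm (A u) <= M * nrm u.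
  move=> Su; have [->|u1] := eqVneq u 0; first by rewrite lin0// nrm0 mulr0.
  have := Mub _ (scaleB u Su u1); rewrite linZ// nrmZ normc_real.
  rewrite ger0_norm ?invr_ge0 ?nrm_ge0// mulrC ler_pdivrMr// nrm_gt0//.
have u00 : u0 != 0 by apply: contra Au0 => /eqP ->; rewrite lin0.
have M0 : 0 < M.
  rewrite -(@pmulr_lgt0 _ (nrm u0)) ?nrm_gt0//.
  by apply: lt_le_trans (MA u0 Su0); rewrite nrm_gt0.
(* The filter of near-maximizers; an ultrafilter finer than [F] plays the role of a maximizing
   sequence. *)
pose F := filter_from [set e : R | 0 < e] (fun e => [set u | B u /\ M - e < nrm (A u)]).
have FF : ProperFilter F.
  apply: filter_from_proper => [|e /= e0]; last first.
    have [_ [u Bu <-] hu] := sup_adherent e0 Esup; by exists u.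
  apply: filter_from_filter; first by exists 1 => /=.
  move=> e d /= e0 d0; exists (Num.min e d); first by rewrite /= lt_min e0.
  move=> u /= [Bu hu]; split; split => //; apply: le_lt_trans hu;
    by rewrite lerD2l lerN2 ge_min lexx ?orbT.
have [U [UU FU]] := ultraFilterLemma FF.
have UB e : 0 < e -> U [set u | B u /\ M - e < nrm (A u)].
  by move=> e0; apply: FU; exists e.
have U1 : U [set u | nrm u <= 1] by apply: filterS (UB 1 ltr01) => u [[]].
have [v v1 vU] := weak_limit UU U1.
have Sv : orth S v.
  move=> s Ss; apply: eq0_normc; apply/eqP; rewrite eq_le normc_ge0 andbT.
  apply/ler_addgt0Pr => e e0; rewrite add0r.
  have /= := weak_limit_seminorm UU U1 v1 vU _ (inner_bounded s) (@inner_tail_small s) e0.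
  have subadd u w : normc (inner (u + w) s) <= normc (inner u s) + normc (inner w s).
    by rewrite innerDl le_normcD.
  move=> /(_ subadd) Us.
  have [u [[[Su _] _] /=]] := filter_ex (filterI (UB 1 ltr01) Us).
  by rewrite innerBl Su// sub0r normcN => /ltW.
have nAv : nrm (A v) = M.
  apply/eqP; rewrite eq_le; apply/andP; split; first exact: Mub.
  apply/ler_addgt0Pr => e e0; have e2 : 0 < e / 2 by rewrite divr_gt0.
  have Us := weak_limit_seminorm UU U1 v1 vU
    (fun u w => nrm_lin_subadd u w lA) (ex_intro2 _ _ C C0 bA) tA e2.
  have [u [[_ hu] /=]] := filter_ex (filterI (UB _ e2) Us).
  rewrite linB// => hd; have := nrm_sub_le (A u) (A v); lra.
have AAv : A (A v) = (M ^+ 2)%:C *: v.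
  (* Expand |A A v - M^2 v|^2: both squares are at most M^4, and the cross term is -2 M^2 <A A v, v>
     = -2 M^2 |A v|^2 = -2 M^4. *)
  apply/eqP; rewrite -subr_eq0 -nrm_eq0 -sqrf_eq0 sqr_nrm eq_le nrm2_ge0 andbT.
  rewrite nrm2B nrm2Z normc_real innerZr sA -nrm_sqr_inner nAv -!sqr_nrm conjc_real.
  rewrite -rmorphM /= ger0_norm ?sqr_ge0//.
  have h1 : nrm (A (A v)) ^+ 2 <= (M * M) ^+ 2.
    have := MA _ (AS _ Sv); rewrite nAv => AAv_le.
    by rewrite lerXn2r ?nnegrE ?nrm_ge0 ?mulr_ge0 ?(ltW M0).
  have h2 : (M ^+ 2) ^+ 2 * nrm v ^+ 2 <= (M ^+ 2) ^+ 2.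
    by rewrite ler_piMr ?sqr_ge0// expr_le1 ?nrm_ge0.
  rewrite -expr2 mulr2n; move: h1; rewrite -expr2; lra.
have [w0|w0] := eqVneq (A v + M%:C *: v) 0.
  exists (- M); first by move=> u Su; rewrite normrN gtr0_norm// MA.
  right; exists v; split => //.
    by apply: contraTneq M0 => v0; rewrite -nAv v0 lin0// nrm0 ltxx.
  by apply/eqP; rewrite rmorphN scaleNr -addr_eq0 w0.
exists M; first by move=> u Su; rewrite gtr0_norm// MA.
right; exists (A v + M%:C *: v); split => //.
  by rewrite addrC; apply: orth_lin => //; exact: AS.
by rewrite linD// linZ// AAv scalerDr scalerA -rmorphM addrC expr2.
Qed.

End WeakCompactness.

(** * Compact normal operators *)

Section NormalOperators.
Variable R : realType.
Local Notation H := (l2_space R).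
Implicit Types (u v w : H) (T S A B : H -> H).

Lemma adjoint_sym T S : is_adjoint T S -> is_adjoint S T.
Proof. by move=> TS u v; rewrite inner_conj -TS -inner_conj. Qed.

Lemma inner_injr u v : (forall z, inner z u = inner z v) -> u = v.
Proof. by move=> h; apply: inner_inj => z; rewrite inner_conj h -inner_conj. Qed.

Lemma adjoint_linear T S : is_adjoint T S -> linear S.
Proof.
move=> TS a u v; apply: inner_injr => z.
by rewrite -TS !innerDr !innerZr -!TS.
Qed.

Definition compact_like T := nrm_bounded (fun u => nrm (T u)) /\
                             tail_small (fun u => nrm (T u)).

Lemma compact_likeD T S : compact_like T -> compact_like S ->
  compact_like (fun u => T u + S u).
Proof.
move=> [[C C0 hC] tT] [[D D0 hD] tS]; split.
  exists (C + D) => [|u]; first by rewrite addr_gt0.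
  by rewrite mulrDl (le_trans (nrmD _ _))// lerD.
move=> e e0; have e2 : 0 < e / 2 by rewrite divr_gt0.
have [N hN] := tT _ e2; have [M hM] := tS _ e2; exists (maxn N M) => u u0.
rewrite [e]splitr mulrDl (le_trans (nrmD _ _))// lerD//.
  by apply: hN => j jN; rewrite u0// leq_max jN.
by apply: hM => j jM; rewrite u0// leq_max jM orbT.
Qed.

Lemma compact_likeZ (a : R[i]) T : normc a = 1 -> compact_like T ->
  compact_like (fun u => a *: T u).
Proof.
move=> a1 [[C C0 hC] tT]; split.
  by exists C => // u; rewrite nrmZ a1 mul1r.
by move=> e /tT[N hN]; exists N => u /hN; rewrite nrmZ a1 mul1r.
Qed.

Lemma nrm_sqr_le (c : R) u : 0 <= c -> nrm u ^+ 2 <= c * nrm u -> nrm u <= c.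
Proof.
move=> c0; have [->//|u0] := eqVneq (nrm u) 0.
by rewrite expr2 ler_pM2r// lt_def u0 nrm_ge0.
Qed.

Lemma nrm_sqr_le_inner u v w : inner u u = inner v w -> nrm u ^+ 2 <= nrm v * nrm w.
Proof.
move=> h; have := cauchy_schwarz v w; rewrite -h -nrm_sqr_inner normc_real.
by rewrite ger0_norm ?sqr_ge0.
Qed.

(** As [A] and [B] commute, the eigenspace of [A] within the orthogonal of [E] is invariant under
    [B]. By self-adjointness it is again the orthogonal of a set, namely [E] together with the range
    of A - alpha, so [selfadjoint_eigenvector] applies to [B] on it. *)
Lemma normal_joint_eigenvector A B (E : set H) (alpha : R) v0 :
  linear A -> is_adjoint A A -> linear B -> is_adjoint B B -> compact_like B ->
  (forall u, A (B u) = B (A u)) -> (forall u, orth E u -> orth E (B u)) ->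
  orth E v0 -> v0 != 0 -> A v0 = alpha%:C *: v0 ->
  exists v (beta : R), [/\ orth E v, v != 0, A v = alpha%:C *: v & B v = beta%:C *: v].
Proof.
move=> lA sA lB sB [bB tB] AB BE Ev0 v00 Av0.
pose E' := E `|` [set A w - alpha%:C *: w | w in setT].
have E'P u : orth E' u <-> orth E u /\ A u = alpha%:C *: u.
  split=> [h|[Eu Au] s]; last first.
    move=> [/Eu//|[w _ <-]].
    by rewrite innerBr innerZr conjc_real -sA Au innerZl subrr.
  split; first by move=> s Es; apply: h; left.
  apply/eqP; rewrite -subr_eq0; apply/eqP; apply: inner_inj => w.
  rewrite inner0l -(h (A w - alpha%:C *: w)); last by right; exists w.
  by rewrite innerBr innerBl innerZr innerZl conjc_real sA.
have BE' u : orth E' u -> orth E' (B u).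
  move=> /E'P[Eu Au]; apply/E'P; split; first exact: BE.
  by rewrite AB Au linZ.
have [beta hb [b0|[v [/E'P[Ev Av] v1 Bv]]]] :=
    @selfadjoint_eigenvector R B E' lB sB bB tB BE'; last by exists v, beta.
(* Here [B] vanishes on that eigenspace, and [v0] itself is a joint eigenvector. *)
exists v0, 0; split => //.
have := hb v0; rewrite b0 normr0 mul0r => /(_ _) h.
rewrite scale0r; apply/eqP; rewrite -nrm_eq0 eq_le nrm_ge0 andbT h//.
by apply/E'P.
Qed.

(* T = (A + iB) / 2 with A = T + S and B = i (S - T) self-adjoint; the largest
   eigenvalue of A (resp. B) in modulus has a joint eigenvector with B (resp. A),
   which is an eigenvector of T. *)
Lemma normal_nrm_le T S (E : set H) (rho : R) : linear T -> is_adjoint T S ->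
  compact_like T -> compact_like S -> (forall u, T (S u) = S (T u)) ->
  (forall u, orth E u -> orth E (T u)) -> (forall u, orth E u -> orth E (S u)) ->
  0 <= rho ->
  (forall lambda v, orth E v -> v != 0 -> T v = lambda *: v -> normc lambda <= rho) ->
  forall u, orth E u -> nrm (T u) <= 2 * rho * nrm u.
Proof.
move=> lT TS cT cS TSc TE SE rho0 hrho u Eu.
have lS := adjoint_linear TS; have ST := adjoint_sym TS.
pose A v := T v + S v; pose B v := 'i *: (S v + (- 1) *: T v).
have ii : 'i * 'i = -1 :> R[i] by rewrite -expr2 sqr_i.
have ci : conjc ('i : R[i]) = - 'i by simpc.
have lA : linear A.
  by move=> a v w; rewrite /A lT lS scalerDr addrACA.
have lB : linear B.
  move=> a v w; rewrite /B lT lS !scalerDr !scalerA !addrA.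
  rewrite !(mulrC a) -!mulrA !(mulrC a) !mulrA [in RHS]addrAC -!addrA; congr (_ + _).
  by rewrite addrCA; congr (_ + _); rewrite addrC.
have sA : is_adjoint A A.
  by move=> v w; rewrite /A innerDl innerDr TS ST addrC.
have sB : is_adjoint B B.
  move=> v w; rewrite /B innerZl innerZr innerDl innerDr innerZl innerZr TS ST ci.
  by rewrite rmorphN rmorph1; ring.
have cA : compact_like A by exact: compact_likeD.
have n1 : normc (- 1 : R[i]) = 1 by rewrite normcN normc1.
have ni : normc ('i : R[i]) = 1 by rewrite /normc /= expr0n add0r expr1n sqrtr1.
have cB : compact_like B.
  by apply: compact_likeZ => //; apply: compact_likeD => //; exact: compact_likeZ.
have AB v : A (B v) = B (A v).
  rewrite /B (linZ _ _ lA) (linD _ _ lA) (linZ _ _ lA).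
  have -> : A (S v) = S (A v) by rewrite /A (linD _ _ lS) TSc.
  by have -> : A (T v) = T (A v) by rewrite /A (linD _ _ lT) TSc.
have orthD v w : orth E v -> orth E w -> orth E (v + w).
  by move=> hv hw; rewrite -[v]scale1r; exact: orth_lin.
have orthZ a v : orth E v -> orth E (a *: v).
  by move=> hv s Es; rewrite innerZl hv// mulr0.
have AE v : orth E v -> orth E (A v) by move=> Ev; apply: orthD; [exact: TE|exact: SE].
have BE v : orth E v -> orth E (B v).
  by move=> Ev; exact: orthZ (orthD _ _ (SE _ Ev) (orthZ _ _ (TE _ Ev))).
have TAB v : T v = 2^-1 *: (A v + 'i *: B v).
  rewrite /A /B scalerA ii !scaleN1r opprD opprK addrA addrK.
  by rewrite -mulr2n -(scaler_nat 2 (T v)) scalerA mulVf ?scale1r.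
have TABe v (a b : R) : A v = a%:C *: v -> B v = b%:C *: v ->
    T v = (2^-1 * (a +i* b)) *: v.
  move=> Av Bv; rewrite TAB Av Bv scalerA -scalerDl scalerA; congr (_ * _ *: _).
  by simpc.
have half (z : R[i]) : normc (2^-1 * z) = normc z / 2.
  by rewrite normcM normcV mulrC -[2]/(2%:R) -(rmorph_nat (real_complex R)) normc_real ger0_norm.
(* The joint eigenvector has eigenvalue (alpha + i beta) / 2 for [T], of modulus at most [rho];
   hence |alpha| <= 2 rho. Likewise for [B], and T = (A + iB) / 2 gives (2 rho + 2 rho) / 2. *)
have hA : nrm (A u) <= 2 * rho * nrm u.
  have [alpha ha [a0|[v0 [Ev0 v00 Av0]]]] :=
      selfadjoint_eigenvector lA sA cA.1 cA.2 AE.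
    by rewrite (le_trans (ha u Eu))// a0 normr0 mul0r !mulr_ge0 ?nrm_ge0.
  have [v [beta [Ev v1 Av Bv]]] := normal_joint_eigenvector lA sA lB sB cB AB BE Ev0 v00 Av0.
  have := hrho _ _ Ev v1 (TABe _ _ _ Av Bv); rewrite half ler_pdivrMr// => h.
  apply: le_trans (ha u Eu) _; rewrite ler_wpM2r ?nrm_ge0// (mulrC 2).
  by apply: le_trans h; exact: (Re_le_normc (alpha +i* beta)).
have hB : nrm (B u) <= 2 * rho * nrm u.
  have [beta ha [a0|[v0 [Ev0 v00 Av0]]]] :=
      selfadjoint_eigenvector lB sB cB.1 cB.2 BE.
    by rewrite (le_trans (ha u Eu))// a0 normr0 mul0r !mulr_ge0 ?nrm_ge0.
  have [v [alpha [Ev v1 Bv Av]]] :=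
    normal_joint_eigenvector lB sB lA sA cA (fun u => esym (AB u)) AE Ev0 v00 Av0.
  have := hrho _ _ Ev v1 (TABe _ _ _ Av Bv); rewrite half ler_pdivrMr// => h.
  apply: le_trans (ha u Eu) _; rewrite ler_wpM2r ?nrm_ge0// (mulrC 2).
  by apply: le_trans h; exact: (Im_le_normc (alpha +i* beta)).
rewrite TAB -[X in nrm (X *: _)]mulr1 nrmZ half normc1.
have := nrmD (A u) ('i *: B u); rewrite nrmZ ni mul1r; lra.
Qed.

(** [x] is bounded from |.|'_1 to the [l_2] norm, and |.|'_1 is at most 1 / (N + 1) times the [l_2]
    norm on vectors whose first N coordinates vanish. *)
Lemma restr_compact_like (x : smooth_op R) : compact_like (restr_l2 x).
Proof.
split.
  have [C C0 h] := restr_bound x 0; exists C => // u.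
  by rewrite -lee_fin -wnorm0E.
have [C C0 h] := smooth_bound x 0 1 => e e0.
have [N hN] : exists N : nat, C / e <= N%:R.
  exists (Num.bound (C / e)); apply/ltW/archi_boundP.
  by rewrite divr_ge0 ?ltW.
exists N => u u0; rewrite -lee_fin -wnorm0E.
apply: le_trans (h _) _ => /=.
have tu : trunc N u = 0.
  by apply/funext => j; rewrite /trunc; case: ifP => [/u0|].
have := wnorm_tail N (- 1%:Z) 1 u; rewrite tu subr0 expr1 addNr wnorm0E => hu.
apply: (@le_trans _ _ (C%:E * (N.+1%:R^-1%:E * (nrm u)%:E))%E).
  by apply: lee_wpmul2l => //; rewrite lee_fin ltW.
rewrite -!EFinM lee_fin mulrA ler_wpM2r ?nrm_ge0// ler_pdivrMr//.
rewrite mulrC -ler_pdivrMr// (le_trans hN)// ler_nat//.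
Qed.

(** [S] is merely a map of [l_2], so the argument for [x] is dualized: |S u|^2 = <x S u, u>, and
    when the first coordinates of [u] vanish only the tail of x S u counts, which is small because
    [x] maps into s. *)
Lemma adjoint_compact_like (x : smooth_op R) S : is_adjoint (restr_l2 x) S ->
  compact_like S.
Proof.
move=> TS; have ST := adjoint_sym TS; split.
  have [[C C0 hC] _] := restr_compact_like x; exists C => // u.
  apply: nrm_sqr_le; first by rewrite mulr_ge0 ?nrm_ge0// ltW.
  apply: le_trans (nrm_sqr_le_inner (esym (TS _ _))) _.
  by rewrite mulrAC ler_wpM2r ?nrm_ge0.
have [C C0 h] := restr_bound x 1 => e e0.
have [N hN] : exists N : nat, C / e <= N%:R.
  exists (Num.bound (C / e)); apply/ltW/archi_boundP.
  by rewrite divr_ge0 ?ltW.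
exists N => u u0; set v := S u.
apply: nrm_sqr_le; first by rewrite mulr_ge0 ?nrm_ge0// ltW.
have -> : e * nrm u * nrm v = (e * nrm v) * nrm u by rewrite mulrAC.
have vE : inner v v = inner (restr_l2 x v - truncl2 N (restr_l2 x v)) u.
  rewrite innerBl -[inner v v]TS -[LHS]subr0; congr (_ - _).
  apply/esym/inner_coord0 => j; rewrite truncl2E.
  by case: ifP => [/u0 ->|_]; rewrite ?conjc0 ?mulr0 ?mul0r.
apply: le_trans (nrm_sqr_le_inner vE) _; rewrite ler_wpM2r ?nrm_ge0//.
rewrite -lee_fin -wnorm0E; apply: le_trans (wnorm_tail N 0 1 _) _.
rewrite add0r expr1.
apply: (@le_trans _ _ (N.+1%:R^-1%:E * (C * nrm v)%:E)%E).
  by apply: lee_wpmul2l; [rewrite lee_fin invr_ge0|exact: h].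
rewrite -EFinM lee_fin mulrA ler_wpM2r ?nrm_ge0// mulrC ler_pdivrMr//.
by rewrite mulrC -ler_pdivrMr// (le_trans hN)// ler_nat.
Qed.

End NormalOperators.

(** * Eigenvectors and eigenprojections *)

Section OrthonormalFamilies.
Variable R : realType.
Local Notation H := (l2_space R).
Implicit Types (u w : H) (v : nat -> H) (T S : H -> H).

Definition orthonormal n v := forall i j, (i < n)%N -> (j < n)%N ->
  inner (v i) (v j) = (i == j)%:R.

Definition proj n v u : H := \sum_(i < n) inner u (v i) *: v i.

Lemma proj_linear n v : linear (proj n v).
Proof.
move=> a u w; rewrite /proj scaler_sumr -big_split; apply: eq_bigr => i _.
by rewrite innerDl innerZl scalerDl scalerA.
Qed.

Lemma inner_proj n v u j : orthonormal n v -> (j < n)%N ->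
  inner (proj n v u) (v j) = inner u (v j).
Proof.
move=> ov jn; rewrite inner_suml (bigD1 (Ordinal jn))//= innerZl ov// eqxx mulr1.
rewrite big1 ?addr0// => i /negPf ij; rewrite innerZl ov//.
by rewrite -(inj_eq val_inj) /= in ij; rewrite ij mulr0.
Qed.

Lemma proj_id n v u : orthonormal n v -> proj n v (proj n v u) = proj n v u.
Proof. by move=> ov; apply: eq_bigr => i _; rewrite inner_proj. Qed.

Lemma proj_selfadjoint n v : is_adjoint (proj n v) (proj n v).
Proof.
move=> u w; rewrite inner_suml inner_sumr; apply: eq_bigr => i _.
by rewrite innerZl innerZr -inner_conj mulrC.
Qed.

Lemma inner_proj_sum n v u :
  inner u (proj n v u) = (\sum_(i < n) normc (inner u (v i)) ^+ 2)%:C.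
Proof.
rewrite inner_sumr rmorph_sum; apply: eq_bigr => i _.
by rewrite innerZr mulrC mulcJ.
Qed.

Lemma bessel n v u : orthonormal n v ->
  \sum_(i < n) normc (inner u (v i)) ^+ 2 <= nrm u ^+ 2.
Proof.
move=> ov; have := nrm2_ge0 (u - proj n v u).
have h : nrm2 (proj n v u) = \sum_(i < n) normc (inner u (v i)) ^+ 2.
  apply: complexI; rewrite -inner_self proj_selfadjoint proj_id//.
  exact: inner_proj_sum.
by rewrite nrm2B h inner_proj_sum /= mulr2n opprD addrA addrK subr_ge0 sqr_nrm.
Qed.

Lemma nrm2_le u (M : R) :
  (forall n, \sum_(0 <= j < n) normc (u j) ^+ 2 <= M) -> nrm2 u <= M.
Proof. by move=> /nrm2_leP[w wu wM]; rewrite (_ : u = w)//; exact: val_inj. Qed.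

Lemma nrm2_truncl2 N u : nrm2 (truncl2 N u) <= \sum_(0 <= j < N) normc (u j) ^+ 2.
Proof.
apply: nrm2_le => n.
have nN : (n <= maxn n N)%N by exact: leq_maxl.
apply: (@le_trans _ _ (\sum_(0 <= j < maxn n N) normc (truncl2 N u j) ^+ 2)).
  rewrite [leRHS](big_cat_nat _ (n := n))//=.
  by rewrite lerDl sumr_ge0// => j _; exact: sqr_ge0.
rewrite (big_cat_nat _ (n := N))//= ?leq_maxr// [X in _ + X]big_nat.
rewrite [X in _ + X]big1 ?addr0; last first.
  by move=> j /andP[Nj _]; rewrite /trunc ltnNge Nj normc0 expr0n.
by rewrite !big_nat ler_sum// => j /andP[_ jN]; rewrite /trunc jN.
Qed.

Lemma nrm2_split N u :
  nrm2 u <= \sum_(0 <= j < N) normc (u j) ^+ 2 + nrm2 (u - truncl2 N u).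
Proof.
rewrite -{1}(subrK (truncl2 N u) u) addrC [leLHS]nrm2D inner_coord0; last first.
  move=> j; rewrite l2_subE truncl2E; case: ifP => _; last by rewrite mul0r.
  by rewrite subrr conjc0 mulr0.
by rewrite mul0rn addr0 lerD2r nrm2_truncl2.
Qed.

(* An eigenvector v of norm one with |lambda| >= r has |v|_q <= C / r, so that
   most of its mass lies on the first coordinates as soon as r is large; but n
   orthonormal vectors have a total mass at most N on the first N coordinates. *)
Lemma eigenvector_count (x : smooth_op R) (q : nat) : exists2 C : R, 0 < C &
  forall n v (r : R), orthonormal n.+1 v -> 0 < r ->
    (forall i, (i < n.+1)%N -> exists2 lambda, r <= normc lambda &
       restr_l2 x (v i) = lambda *: v i) ->
    r * n.+1%:R ^+ q <= C.
Proof.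
have [C C0 hC] := restr_bound x q.
exists (2 ^+ q * (2 * C)) => [|n v r ov r0 hv]; first by rewrite !mulr_gt0// exprn_gt0.
(* With [N] half the number of vectors, at least half of the total mass [n.+1] lies beyond the first
   [N] coordinates. [X] bounds the norm of each tail, so 1 <= 2 X^2 and thus 1 <= 2 X, whence the
   factor 2 of [C]; the factor 2^q comes from n + 1 <= 2 (N + 1). *)
pose N := n.+1./2; pose X := C / (r * N.+1%:R ^+ q).
have N0 : 0 < N.+1%:R ^+ q :> R by rewrite exprn_gt0.
have X0 : 0 < X by rewrite divr_gt0// mulr_gt0.
have v1 i : (i < n.+1)%N -> nrm2 (v i) = 1.
  by move=> im; apply: complexI; rewrite -inner_self ov// eqxx.
have nv1 i : (i < n.+1)%N -> nrm (v i) = 1 by move=> /v1; rewrite /nrm => ->; exact: sqrtr1.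
have tail i : (i < n.+1)%N -> nrm2 (v i - truncl2 N (v i)) <= X ^+ 2.
  move=> im; rewrite -sqr_nrm lerXn2r ?nnegrE ?nrm_ge0 ?(ltW X0)//.
  rewrite -lee_fin -wnorm0E; apply: le_trans (wnorm_tail N 0 q _) _.
  have -> : X = (N.+1%:R ^+ q)^-1 * (C / r) by rewrite /X invfM; ring.
  rewrite add0r EFinM lee_wpmul2l ?lee_fin ?invr_ge0 ?(ltW N0)//.
  have [lambda lr Tv] := hv i im.
  have vf : (wnorm q (v i) < +oo)%E.
    rewrite (_ : v i = lambda^-1 *: restr_l2 x (v i)); last first.
      by rewrite Tv scalerA mulVf ?scale1r// -normc_gt0 (lt_le_trans r0).
    by apply: wnorm_ltyZ; apply: le_lt_trans (hC _) _; rewrite ltry.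
  have := hC (v i); rewrite Tv (wnormZ q) nv1// mulr1 (wnorm_finE vf) -EFinM.
  rewrite !lee_fin ler_pdivlMr//; apply: le_trans.
  by rewrite mulrC ler_wpM2r// fine_ge0// wnorm_ge0.
have sum1 : n.+1%:R <= \sum_(i < n.+1) (\sum_(0 <= j < N) normc (v i j) ^+ 2 + X ^+ 2).
  rewrite -[n.+1 in leLHS]card_ord -sum1_card natr_sum; apply: ler_sum => i _.
  by rewrite -(v1 i (ltn_ord i)) (le_trans (nrm2_split N _))// lerD2l tail.
(* Bessel's inequality for the j-th unit vector: the j-th coordinates of the [v i] have square sum
   at most 1. *)
have sum2 : \sum_(i < n.+1) \sum_(0 <= j < N) normc (v i j) ^+ 2 <= N%:R.
  have -> : N%:R = \sum_(0 <= j < N) (1 : R) by rewrite sumr_const_nat subn0.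
  rewrite exchange_big/=; apply: ler_sum => j _.
  have := bessel (unitv R j) ov; rewrite nrm_unitv expr1n; apply: le_trans.
  apply: ler_sum => i _.
  by rewrite inner_conj inner_unitv normc_conj.
have N2 : N%:R <= n.+1%:R / 2 :> R.
  rewrite ler_pdivlMr// -natrM ler_nat muln2 -[leqRHS](odd_double_half n.+1).
  exact: leq_addl.
have N3 : n.+1%:R / 2 <= N.+1%:R :> R.
  rewrite ler_pdivrMr// -natrM ler_nat muln2 -[leqLHS](odd_double_half n.+1).
  by rewrite doubleS -addn2 addnC leq_add2l; case: odd.
have n0 : 0 < n.+1%:R :> R by rewrite ltr0n.
have X1 : 1 <= 2 * X ^+ 2.
  have : n.+1%:R * 1 <= n.+1%:R * (2 * X ^+ 2).
    move: sum1; rewrite big_split/= sumr_const card_ord -mulr_natl.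
    move: sum2 N2; set s := \sum_(i < _) _; lra.
  by rewrite ler_pM2l.
have X2 : 1 <= 2 * X by nra.
have rN : r * N.+1%:R ^+ q <= 2 * C.
  by move: X2; rewrite /X mulrA ler_pdivlMr ?mul1r// mulr_gt0.
have nN : n.+1%:R ^+ q <= 2 ^+ q * N.+1%:R ^+ q :> R.
  by rewrite -exprMn lerXn2r ?nnegrE ?mulr_ge0// mulrC -ler_pdivrMr.
apply: (@le_trans _ _ (r * (2 ^+ q * N.+1%:R ^+ q))); first by rewrite ler_pM2l.
by rewrite mulrCA ler_pM2l// exprn_gt0.
Qed.

(** Counting with q = 1 bounds the size of orthonormal families in the eigenspace. For a family of
    maximal size, the part of an eigenvector orthogonal to it must vanish, since after normalization
    it would extend the family. *)
Lemma eigen_basis (x : smooth_op R) (lambda : R[i]) : lambda != 0 ->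
  exists n v, [/\ orthonormal n v,
    forall i, (i < n)%N -> restr_l2 x (v i) = lambda *: v i &
    forall u, restr_l2 x u = lambda *: u -> proj n v u = u].
Proof.
move=> l0; set T := restr_l2 x; have lT : linear T := restr_linear x.
pose Pn n := `[< exists v, orthonormal n v /\
   forall i, (i < n)%N -> T (v i) = lambda *: v i >].
have P0 : exists n, Pn n by exists 0%N; apply/asboolP; exists (fun=> 0).
have [C C0 hC] := eigenvector_count x 1.
have nl : 0 < normc lambda by rewrite normc_gt0.
have Pb n : Pn n -> (n <= Num.bound (C / normc lambda))%N.
  case: n => // n /asboolP[v [ov Tv]].
  have := hC n v (normc lambda) ov nl (fun i im => ex_intro2 _ _ lambda (lexx _) (Tv i im)).
  rewrite expr1 mulrC -ler_pdivlMr// => h.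
  rewrite -(ler_nat R); apply: le_trans h (ltW (archi_boundP _)).
  by rewrite divr_ge0 ?ltW.
case: (ex_maxnP P0 Pb) => n /asboolP[v [ov Tv]] nmax.
exists n, v; split=> // u Tu; apply/eqP; rewrite -subr_eq0 -oppr_eq0 opprB.
set w := u - proj n v u; apply/negPn/negP => w0.
have wv i : (i < n)%N -> inner w (v i) = 0.
  by move=> im; rewrite innerBl inner_proj// subrr.
have Tw : T w = lambda *: w.
  rewrite linB// Tu scalerBr; congr (_ - _).
  rewrite lin_sum// scaler_sumr; apply: eq_bigr => i _.
  by rewrite linZ// Tv// !scalerA mulrC.
pose v' i := if (i < n)%N then v i else ((nrm w)^-1)%:C *: w.
have : Pn n.+1.
  apply/asboolP; exists v'; split=> [i j|i im]; last first.
    by rewrite /v'; case: ifP => [/Tv//|_]; rewrite linZ// Tw !scalerA mulrC.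
  rewrite !ltnS /v' => iN jN; case: ltnP => [im|ni]; case: ltnP => [jm|nj].
  - exact: ov.
  - rewrite innerZr inner_conj wv// conjc0 mulr0.
    by rewrite (gtn_eqF (leq_trans im nj)) || rewrite (ltn_eqF (leq_trans im nj)).
  - by rewrite innerZl wv// mulr0 gtn_eqF// (leq_trans jm).
  - have -> : i = j.
      by apply/eqP; rewrite eqn_leq (leq_trans iN nj) (leq_trans jN ni).
    rewrite eqxx innerZl innerZr -nrm_sqr_inner conjc_real -!rmorphM /=.
    by rewrite expr2 mulKf ?nrm_eq0// mulVf ?nrm_eq0.
by move=> /nmax; rewrite ltnn.
Qed.

Lemma bounded_continuous T : linear T -> nrm_bounded (fun u => nrm (T u)) -> continuous T.
Proof.
move=> lT [C C0 hT]; apply/continuousP => A oA; suff : open_l2 (T @^-1` A) by [].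
move=> u Au; have [e e0 eA] := (oA : open_l2 A) _ Au.
exists (e / C) => [|w h]; first by rewrite divr_gt0.
apply: eA; move: h; rewrite -[X in wnorm 0 X]/(l2_val (w - u)).
rewrite -[X in _ -> (wnorm 0 X < _)%E]/(l2_val (T w - T u)) -linB// !wnorm0E !lte_fin.
by rewrite ltr_pdivlMr// mulrC; exact: le_lt_trans.
Qed.

(** * Eigenspaces of a normal operator *)

Section Eigenprojections.
Variables (x : smooth_op R) (S : H -> H).
Hypotheses (xS : is_adjoint (restr_l2 x) S)
  (Sx : forall u, restr_l2 x (S u) = S (restr_l2 x u)).
Let T := restr_l2 x.
Let lT : linear T := restr_linear x.

(** Normality makes |S u - conj(lambda) u| equal to |T u - lambda u|. *)
Lemma adjoint_eigenvector lambda u : T u = lambda *: u -> S u = conjc lambda *: u.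
Proof.
move=> Tu; apply/eqP; rewrite -subr_eq0 -nrm_eq0 -sqrf_eq0; apply/eqP/complexI.
have Sx' := adjoint_sym xS.
rewrite nrm_sqr_inner !(innerBl, innerBr) -[inner (S u) (S u)]xS Sx Sx' -/T Tu.
rewrite !innerZl !innerZr Sx' -xS -/T Tu innerZl innerZr conjcK.
by ring.
Qed.

Lemma eigenvectors_orthogonal lambda mu u w : lambda != mu ->
  T u = lambda *: u -> T w = mu *: w -> inner u w = 0.
Proof.
move=> lm Tu Tw; have := xS u w; rewrite -/T Tu (adjoint_eigenvector Tw).
rewrite innerZl innerZr conjcK => /eqP.
by rewrite -subr_eq0 -mulrBl mulf_eq0 subr_eq0 (negPf lm) => /eqP.
Qed.

(** The last two clauses are the two inclusions between range and eigenspace. This is the common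
    interface: existence constructs such projections, and those of any given representation turn out
    to be of this kind. *)
Definition eigenprojection lambda (P : smooth_op R) :=
  [/\ projection (restr_l2 P), finite_rank (restr_l2 P),
      forall u, T (restr_l2 P u) = lambda *: restr_l2 P u &
      forall u, T u = lambda *: u -> restr_l2 P u = u].

(* Since v_i = lambda^-1 x v_i and <u, v_i> = lambda^-1 <x u, v_i>, the projection
   sum_i <., v_i> v_i can be written in terms of x, which extends it to s'. *)
Lemma eigenprojection_exists lambda : lambda != 0 ->
  exists P, eigenprojection lambda P.
Proof.
move=> l0; have [n [v [ov Tv hv]]] := eigen_basis x l0.
pose f (xi : sdual_space R) : s_space R :=
  \sum_(i < n) inner (s_to_l2 (x xi)) (v i) *: (lambda ^- 2 *: x (l2_to_sdual (v i))).
have fl : linear f.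
  move=> a xi eta; rewrite /f scaler_sumr -big_split; apply: eq_bigr => i _.
  have -> : s_to_l2 (x (a *: xi + eta)) = a *: s_to_l2 (x xi) + s_to_l2 (x eta).
    by apply: l2P => j; rewrite linearP.
  by rewrite innerDl innerZl scalerDl -scalerA.
pose fL : {linear sdual_space R -> s_space R} :=
  HB.pack f (GRing.isLinear.Build _ _ _ _ f fl).
have fc : continuous fL.
  apply: bounded_smooth => q p.
  have [C C0 hC] := smooth_bound x 0 p.
  pose D := \sum_(i < n) (nrm (v i) * (fine (wnorm q (lambda ^- 2 *: x (l2_to_sdual (v i)))))).
  have D0 : 0 <= D by apply: sumr_ge0 => i _; rewrite mulr_ge0 ?nrm_ge0// fine_ge0 ?wnorm_ge0.
  exists (C * (D + 1)) => [|xi]; first by rewrite mulr_gt0// ltr_wpDl.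
  have h1 : (wnorm q (f xi) <= (nrm (s_to_l2 (x xi)) * D)%:E)%E.
    rewrite /f /D mulr_sumr.
    elim/big_rec2 : _ => [|i y1 y2 _ h]; first by rewrite [leLHS]wnorm0.
    apply: le_trans (wnormD _ _ _) _; rewrite EFinD; apply: leeD => //.
    rewrite (wnormZ q) (wnorm_finE (wnorm_s_fin _ _)) -EFinM lee_fin mulrA.
    by rewrite ler_wpM2r ?fine_ge0 ?wnorm_ge0// cauchy_schwarz.
  apply: le_trans h1 _; rewrite EFinM -wnorm0E muleC mulrC EFinM -muleA.
  apply: lee_pmul;
    [by rewrite lee_fin|exact: wnorm_ge0|by rewrite lee_fin lerDl|exact: hC].
pose P := SmoothOp fc.
have PE u : restr_l2 P u = proj n v u.
  apply: val_inj; rewrite -[LHS]/(s_val (f (l2_to_sdual u))).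
  have -> : s_val (f (l2_to_sdual u)) = l2_val (s_to_l2 (f (l2_to_sdual u))) by [].
  congr l2_val.
  rewrite /f s_to_l2_sum; apply: eq_bigr => i _.
  transitivity (inner (T u) (v i) *: (lambda ^- 2 *: T (v i))); first exact: val_inj.
  rewrite /T xS (adjoint_eigenvector (Tv i (ltn_ord i))) Tv// innerZr conjcK !scalerA.
  by congr (_ *: _); field.
have rPE : restr_l2 P = proj n v by apply/funext.
exists P; rewrite /eigenprojection rPE; split => //.
- split; [exact: proj_linear| |by move=> u; exact: proj_id|exact: proj_selfadjoint].
  rewrite -rPE; apply: bounded_continuous; first exact: restr_linear.
  exact: (restr_compact_like P).1.
- by exists n, (fun i => v i) => u; exists (fun i => inner u (v i)).
- move=> u; rewrite lin_sum// scaler_sumr; apply: eq_bigr => i _.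
  by rewrite linZ// /T Tv// !scalerA mulrC.
Qed.

End Eigenprojections.
End OrthonormalFamilies.

(** * The eigenvalues in decreasing order of modulus *)

Section Eigenvalues.
Variable R : realType.
Local Notation H := (l2_space R).
Implicit Types (u v w : H) (L : seq R[i]).

Lemma finite_rank0 : finite_rank (fun _ : H => 0).
Proof. by exists 0%N, (fun=> 0) => u; exists (fun=> 0); rewrite big_ord0. Qed.

Lemma finite_rankD (A B : H -> H) : finite_rank A -> finite_rank B ->
  finite_rank (fun u => A u + B u).
Proof.
move=> [m [e he]] [n [f hf]].
exists (m + n)%N, (fun i => match fintype.split i with inl j => e j | inr k => f k end) => u.
have [c ->] := he u; have [d ->] := hf u.
exists (fun i => match fintype.split i with inl j => c j | inr k => d k end).
rewrite big_split_ord /=; congr (_ + _); apply: eq_bigr => i _.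
  by rewrite -[lshift n i]/(fintype.unsplit (inl i)) unsplitK.
by rewrite -[rshift m i]/(fintype.unsplit (inr i)) unsplitK.
Qed.

Lemma finite_rankZ (a : R[i]) (A : H -> H) : finite_rank A ->
  finite_rank (fun u => a *: A u).
Proof.
move=> [m [e he]]; exists m, e => u; have [c ->] := he u.
exists (fun i => a * c i); rewrite scaler_sumr.
by apply: eq_bigr => i _; rewrite scalerA.
Qed.

Lemma finite_rank_sum (I : eqType) (s : seq I) (A : I -> H -> H) :
  (forall i, i \in s -> finite_rank (A i)) -> finite_rank (fun u => \sum_(i <- s) A i u).
Proof.
elim: s => [|i s IH] hA.
  by under eq_fun do rewrite big_nil; exact: finite_rank0.
under eq_fun do rewrite big_cons; apply: finite_rankD; first exact: hA (mem_head _ _).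
by apply: IH => j js; apply: hA; rewrite inE js orbT.
Qed.

Definition is_eigenvalue (x : smooth_op R) lambda :=
  lambda != 0 /\ exists2 v, v != 0 & restr_l2 x v = lambda *: v.

Section Enumeration.
Variables (x : smooth_op R) (S : H -> H).
Hypotheses (xS : is_adjoint (restr_l2 x) S)
  (Sx : forall u, restr_l2 x (S u) = S (restr_l2 x u)).
Let T := restr_l2 x.
Let lT : linear T := restr_linear x.
Let eig_orth := eigenvectors_orthogonal xS Sx.

(** Unit eigenvectors for distinct eigenvalues are orthonormal by normality. The case q = 1 gives
    finiteness above any modulus, and all q together give rapid decay. *)
Lemma eigenvalue_count (q : nat) : exists2 C : R, 0 < C &
  forall n (lam : nat -> R[i]) (r : R), 0 < r ->
    (forall i, (i < n.+1)%N -> is_eigenvalue x (lam i) /\ r <= normc (lam i)) ->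
    (forall i j, (i < n.+1)%N -> (j < n.+1)%N -> lam i = lam j -> i = j) ->
    r * n.+1%:R ^+ q <= C.
Proof.
have [C C0 hC] := eigenvector_count x q; exists C => // n lam r r0 hl linj.
have /choice[v hv] i : exists v : H, (i < n.+1)%N ->
    inner v v = 1 /\ T v = lam i *: v.
  have [im|] := ltnP i n.+1; last by exists 0.
  have [[_ [v v0 Tv]] _] := hl i im; exists (((nrm v)^-1)%:C *: v) => _; split.
    rewrite innerZl innerZr -nrm_sqr_inner conjc_real -!rmorphM /=.
    by rewrite expr2 mulKf ?nrm_eq0// mulVf ?nrm_eq0.
  by rewrite linZ// /T Tv !scalerA mulrC.
apply: (hC n v r) => // [i j im jm|i im]; last first.
  by exists (lam i); [exact: (hl i im).2|exact: (hv i im).2].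
have [->|ij] := eqVneq i j; first exact: (hv j jm).1.
apply: (eig_orth _ (hv i im).2 (hv j jm).2).
by apply: contra ij => /eqP /linj ->.
Qed.

Lemma finite_eigenvalues (r : R) : 0 < r ->
  finite_set [set lambda | is_eigenvalue x lambda /\ r <= normc lambda].
Proof.
move=> r0; apply: contrapT => /infinite_set_fset inf.
have [C C0 hC] := eigenvalue_count 1.
pose n := Num.bound (C / r).
have [B sB] := inf n.+1; rewrite -/(size _) => nB.
have := hC n (nth 0 (finmap.enum_fset B)) r r0.
have : C / r < n.+1%:R.
  apply: (lt_trans (archi_boundP _)); first by rewrite divr_ge0 ?ltW.
  by rewrite ltr_nat.
rewrite ltr_pdivrMr// mulrC expr1 ltNge => /negP h1 h2; apply/h1/h2.
  move=> i iB; apply: sB => /=.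
  by have := mem_nth 0 (leq_trans iB nB).
move=> i j iB jB /eqP; rewrite nth_uniq ?finmap.fset_uniq ?(leq_trans iB nB) ?(leq_trans jB nB)//.
by move=> /eqP.
Qed.

Variable Pc : R[i] -> smooth_op R.
Hypothesis hPc : forall lambda, lambda != 0 -> eigenprojection x lambda (Pc lambda).

Let Pl lambda : H -> H := restr_l2 (Pc lambda).

(** The remainder is T (u - Pu), and u - Pu is orthogonal to the eigenspaces for [L]. That
    orthogonal is invariant under [T] and [S], and the nonzero eigenvalues of [T] on it are outside
    [L], so [normal_nrm_le] applies. *)
Lemma nrm_remainder_le L (rho : R) : uniq L -> (forall l, l \in L -> l != 0) -> 0 <= rho ->
  (forall mu, is_eigenvalue x mu -> mu \notin L -> normc mu <= rho) ->
  forall u, nrm (T u - \sum_(l <- L) l *: Pl l u) <= 2 * rho * nrm u.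
Proof.
move=> uL L0 rho0 hrho u.
pose E := [set w | exists2 l, l \in L & T w = l *: w].
pose Pu := \sum_(l <- L) Pl l u.
have PT l w : l \in L -> T (Pl l w) = l *: Pl l w.
  by move=> /L0 /hPc[_ _ h _]; exact: h.
have Psa l : l \in L -> is_adjoint (Pl l) (Pl l).
  by move=> /L0 /hPc[[_ _ _ h] _ _ _].
have Pid l w : l \in L -> T w = l *: w -> Pl l w = w.
  by move=> /L0 /hPc[_ _ _ h]; exact: h.
have Ed : orth E (u - Pu).
  move=> w [m mL Tw]; rewrite innerBl inner_suml (bigD1_seq m)//=.
  rewrite Psa// Pid// big_seq_cond big1 ?addr0 ?subrr// => l /andP[lL lm].
  exact: (eig_orth lm (PT l u lL) Tw).
have dPu : inner (u - Pu) Pu = 0.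
  rewrite inner_sumr big_seq big1// => l lL; apply: Ed; exists l => //; exact: PT.
have du : nrm (u - Pu) <= nrm u.
  have uE : nrm2 u = nrm2 (u - Pu) + nrm2 Pu.
    by have := nrm2D (u - Pu) Pu; rewrite subrK dPu mul0rn addr0.
  by rewrite /nrm ler_sqrt ?nrm2_ge0// uE lerDl nrm2_ge0.
have -> : T u - \sum_(l <- L) l *: Pl l u = T (u - Pu).
  rewrite linB// /Pu lin_sum//; congr (_ - _).
  by rewrite !big_seq; apply: eq_bigr => l lL; rewrite PT.
have xS' := adjoint_sym xS.
apply: (@le_trans _ _ (2 * rho * nrm (u - Pu))); last first.
  by rewrite ler_wpM2l ?mulr_ge0.
apply: (@normal_nrm_le R T S E) => //.
- exact: restr_compact_like.
- exact: adjoint_compact_like xS.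
- move=> v Ev w [m mL Tw]; rewrite xS (adjoint_eigenvector xS Sx Tw) innerZr.
  by rewrite Ev ?mulr0//; exists m.
- move=> v Ev w [m mL Tw]; rewrite xS' -/T Tw innerZr.
  by rewrite Ev ?mulr0//; exists m.
move=> m v Ev v0 Tv; have [->|m0] := eqVneq m 0; first by rewrite normc0.
apply: hrho; first by split=> //; exists v.
(* An eigenvector in the orthogonal of [E] with eigenvalue in [L] would be orthogonal to itself. *)
apply: contra v0 => mL; rewrite -nrm_eq0 -sqrf_eq0; apply/eqP/complexI.
by rewrite nrm_sqr_inner Ev//; exists m.
Qed.

Hypothesis inf_rank : ~ finite_rank T.

(** If [L] contained all nonzero eigenvalues, the remainder bound with [rho = 0] would make [T] of
    finite rank. Given one further eigenvalue, only finitely many have at least its modulus, and the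
    largest of these outside [L] is taken. *)
Lemma new_eigenvalue L : exists lambda, [/\ is_eigenvalue x lambda, lambda \notin L &
  forall mu, is_eigenvalue x mu -> mu \notin L -> normc mu <= normc lambda].
Proof.
have [l0 [el0 l0L]] : exists l0, is_eigenvalue x l0 /\ l0 \notin L.
  apply: contrapT => /forallNP hn; apply: inf_rank.
  (* [L] is arbitrary, while the remainder bound wants distinct nonzero entries. *)
  pose L' := [seq l <- undup L | l != 0].
  have hL l : l \in L' -> l != 0 by rewrite mem_filter => /andP[].
  rewrite (_ : T = fun u => \sum_(l <- L') l *: Pl l u).
    apply: finite_rank_sum => l /hL l0; apply: finite_rankZ.
    by have [] := hPc l0.
  apply/funext => u; apply/eqP; rewrite -subr_eq0 -nrm_eq0 eq_le nrm_ge0 andbT.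
  have -> : 0 = 2 * 0 * nrm u by rewrite mulr0 mul0r.
  apply: nrm_remainder_le => //; first by rewrite filter_uniq ?undup_uniq.
  move=> mu emu muL; have := hn mu; rewrite not_andE => -[//|].
  move=> /negP; rewrite negbK => muL2; move: muL.
  by rewrite mem_filter mem_undup muL2 andbT emu.1.
have r0 : 0 < normc l0 by rewrite normc_gt0 el0.1.
have /finite_seqP[s hs] := finite_eigenvalues r0.
have sP l : l \in s <-> is_eigenvalue x l /\ normc l0 <= normc l.
  by rewrite -[_ /\ _]/([set l | is_eigenvalue x l /\ normc l0 <= normc l] l) hs.
pose s' := [seq l <- s | l \notin L].
have l0s : l0 \in s' by rewrite mem_filter l0L; apply/sP; split.
have [l ls lmax] : exists2 l, l \in s' & forall m, m \in s' -> normc m <= normc l.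
  elim: (s') l0 l0s {el0 l0L r0 hs sP} => // a t IH l0 _.
  case: t IH => [|b t] IH; first by exists a; rewrite ?mem_head// => m; rewrite inE => /eqP ->.
  have [l lt hl] := IH b (mem_head _ _).
  have [al|la] := leP (normc a) (normc l).
    exists l; first by rewrite inE lt orbT.
    by move=> m; rewrite inE => /orP[/eqP ->//|/hl].
  exists a; first by rewrite mem_head.
  move=> m; rewrite inE => /orP[/eqP ->//|/hl ml].
  exact: le_trans ml (ltW la).
move: ls; rewrite mem_filter => /andP[lL /sP[el l0l]].
exists l; split=> // mu emu muL; have [h|h] := leP (normc l0) (normc mu).
  by apply: lmax; rewrite mem_filter muL; apply/sP.
exact: le_trans (ltW h) l0l.
Qed.

(** Greedy choice relative to the list of eigenvalues already picked. The last clause is the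
    hypothesis that bounds the remainder after [n] terms by twice the modulus of [lam n]. *)
Lemma eigenvalue_enumeration : exists lam : nat -> R[i],
  [/\ injective lam, forall n, is_eigenvalue x (lam n),
      forall n, normc (lam n.+1) <= normc (lam n) &
      forall n mu, is_eigenvalue x mu -> mu \notin mkseq lam n ->
        normc mu <= normc (lam n)].
Proof.
have [pk hpk] := choice new_eigenvalue.
pose Ls := fix Ls n := if n is m.+1 then rcons (Ls m) (pk (Ls m)) else [::].
pose lam n := pk (Ls n).
have LsE n : Ls n = mkseq lam n.
  by elim: n => // n IH; rewrite mkseqS -IH.
have lamN n : lam n \notin mkseq lam n by rewrite -LsE; have [] := hpk (Ls n).
have lt_neq m n : (m < n)%N -> lam m != lam n.
  by move=> mn; apply: contraNneq (lamN n) => <-; apply/mapP; exists m; rewrite // mem_iota.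
exists lam; split.
- move=> m n; case: (ltngtP m n) => // /lt_neq /eqP h e; [by case: h|by case: h].
- by move=> n; have [] := hpk (Ls n).
(* [lam n.+1] was already a candidate when [lam n] was chosen. *)
- move=> n; have [_ _] := hpk (Ls n); apply; first by have [] := hpk (Ls n.+1).
  by have := lamN n.+1; rewrite mkseqS mem_rcons inE negb_or LsE => /andP[].
- by move=> n mu emu; rewrite -LsE; have [_ _] := hpk (Ls n); apply.
Qed.

End Enumeration.
End Eigenvalues.

(** * Rapid decay *)

Section RapidDecay.
Variable R : realType.
Local Notation H := (l2_space R).
Implicit Types (u v w : H).

Lemma in_s_decay (a : nat -> R[i]) (k : nat) : a \in @in_s R ->
  exists2 C : R, 0 < C & forall n, normc (a n) * n.+1%:R ^+ k <= C.
Proof.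
move=> /asboolP/(_ k)/weight_l2[x xE _]; exists (nrm x + 1) => [|n].
  by rewrite ltr_wpDl ?nrm_ge0.
have := normc_coord x n; rewrite xE normc_weight mulrC => /le_trans; apply.
by rewrite lerDl.
Qed.

Lemma sum_inv_sqr_le (N M : nat) :
  \sum_(N <= j < M) (j.+1%:R ^+ 2)^-1 <= 2 / N.+1%:R :> R.
Proof.
have [NM|MN] := leqP N M; last by rewrite big_geq ?divr_ge0// ltnW.
(* Strengthened so that the induction telescopes; the step is 1/t^2 <= 2/t - 2/(t + 1), valid for t
   >= 1. *)
suff h : \sum_(N <= j < M) (j.+1%:R ^+ 2)^-1 <= 2 / N.+1%:R - 2 / M.+1%:R :> R.
  by apply: le_trans h _; rewrite gerBl divr_ge0.
rewrite -(subnKC NM); elim: (M - N)%N => [|d IH].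
  by rewrite addn0 big_geq// subrr.
rewrite addnS big_nat_recr/= ?leq_addr//; apply: le_trans (lerD IH (lexx _)) _.
set m := (N + d)%N; rewrite -addrA lerD2l.
have m0 : 0 < m.+1%:R :> R by rewrite ltr0n.
have -> : m.+2%:R = m.+1%:R + 1 :> R by rewrite natr1.
have m1 : 1 <= m.+1%:R :> R by rewrite ler1n.
move: (m.+1%:R : R) m0 m1 => t t0 t1.
have -> : - (2 / t) + (t ^+ 2)^-1 = (1 - 2 * t) / t ^+ 2 by field; rewrite gt_eqF.
rewrite ler_pdivrMr ?exprn_gt0// mulNr lerNr mulrAC ler_pdivrMr ?addr_gt0//.
rewrite expr2; nra.
Qed.

Lemma decay_in_s (a : nat -> R[i]) :
  (forall k : nat, exists C : R, forall n, normc (a n) * n.+1%:R ^+ k <= C) ->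
  a \in @in_s R.
Proof.
(* One power more than [q] leaves weighted squares dominated by a multiple of 1/(j + 1)^2. *)
move=> ha; apply/asboolP => q; have [C hC] := ha q.+1.
have C0 : 0 <= C by apply: le_trans (hC 0%N); rewrite mulr_ge0 ?normc_ge0// exprn_ge0.
have h n : \sum_(0 <= j < n) normc (weight q a j) ^+ 2 <= C ^+ 2 * 2.
  apply: (@le_trans _ _ (C ^+ 2 * \sum_(0 <= j < n) (j.+1%:R ^+ 2)^-1)).
    rewrite mulr_sumr; apply: ler_sum => j _.
    rewrite -exprVn -exprMn lerXn2r ?nnegrE ?normc_ge0 ?mulr_ge0 ?invr_ge0//.
    rewrite normc_weight ler_pdivlMr//; have := hC j.
    by rewrite exprSr mulrA [normc _ * _]mulrC.
  by rewrite ler_wpM2l ?sqr_ge0// (le_trans (sum_inv_sqr_le 0 n))// divr1.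
have [x xE _] := nrm2_leP h.
by rewrite -wnorm_weight -xE wnorm0E ltry.
Qed.

(** As |u| = 1, each interpolation squares the left side and doubles the order on the right. *)
Lemma iterated_interpolation u (q m : nat) : nrm u = 1 ->
  (forall k : nat, (wnorm k u < +oo)%E) ->
  fine (wnorm q u) ^+ (2 ^ m) <= fine (wnorm (2 ^ m * q)%N u).
Proof.
move=> u1 uf; elim: m => [|m IH]; first by rewrite expn0 expr1 mul1n.
rewrite expnSr exprM; have p0 : 0 <= fine (wnorm q u) ^+ (2 ^ m).
  by rewrite exprn_ge0// fine_ge0// wnorm_ge0.
apply: (@le_trans _ _ (fine (wnorm (2 ^ m * q)%N u) ^+ 2)).
  by rewrite lerXn2r ?nnegrE// fine_ge0 ?wnorm_ge0.
have := wnorm_interpolation (uf (2 * (2 ^ m * q))%N).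
rewrite wnorm0E u1 mul1e (wnorm_finE (uf _)) (wnorm_finE (uf (2 * _)%N)) -EFin_expe lee_fin.
by rewrite -mulnA mulnCA.
Qed.

Section Eigen.
Variable x : smooth_op R.

Lemma eigenvector_fin lambda u (k : nat) : lambda != 0 ->
  restr_l2 x u = lambda *: u -> (wnorm k u < +oo)%E.
Proof.
move=> l0 Tu; have [C C0 hC] := restr_bound x k.
rewrite (_ : u = lambda^-1 *: restr_l2 x u); last by rewrite Tu scalerA mulVf ?scale1r.
by apply: wnorm_ltyZ; apply: le_lt_trans (hC _) _; rewrite ltry.
Qed.

(** [K] bounds [x] from [l_2] to the norm of order 2^m q; a unit eigenvector has norm at most K /
    |lambda| there, and interpolating back to order q takes the 2^m-th root. *)
Lemma eigenvector_norm (q m : nat) : exists2 K : R, 0 < K &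
  forall lambda u, lambda != 0 -> restr_l2 x u = lambda *: u ->
    (wnorm q u <= ((K / normc lambda) `^ (2 ^ m)%:R^-1 * nrm u)%:E)%E.
Proof.
have [K K0 hK] := restr_bound x (2 ^ m * q); exists K => // lambda u l0 Tu.
have nl : 0 < normc lambda by rewrite normc_gt0.
have uf k := eigenvector_fin k l0 Tu.
have [u0|u0] := eqVneq u 0; first by rewrite u0 wnorm0 nrm0 mulr0.
have nu : 0 < nrm u by rewrite nrm_gt0.
pose w := ((nrm u)^-1)%:C *: u.
have w1 : nrm w = 1 by rewrite nrmZ normc_real gtr0_norm ?invr_gt0// mulVf// gt_eqF.
have Tw : restr_l2 x w = lambda *: w.
  by rewrite (linZ _ _ (@restr_linear R x)) Tu !scalerA mulrC.
have wf k := eigenvector_fin k l0 Tw.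
have h1 : fine (wnorm (2 ^ m * q)%N w) <= K / normc lambda.
  rewrite ler_pdivlMr//; have := hK w; rewrite Tw (wnormZ (2 ^ m * q)%N) w1 mulr1.
  by rewrite (wnorm_finE (wf _)) -EFinM lee_fin mulrC.
set D := _ `^ _; have D0 : 0 <= D by exact: powR_ge0.
have h2 : fine (wnorm q w) <= D.
  have m0 : (0 < 2 ^ m)%N by rewrite expn_gt0.
  rewrite -(ler_pXn2r m0) ?nnegrE ?fine_ge0 ?wnorm_ge0//.
  apply: le_trans (iterated_interpolation q m w1 wf) _.
  rewrite -powR_mulrn// /D -powRrM mulVf ?pnatr_eq0 -?lt0n// powRr1//.
  by rewrite divr_ge0// ltW.
rewrite -lee_fin -(wnorm_finE (wf q)) (wnormZ q) normc_real gtr0_norm ?invr_gt0// in h2.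
by rewrite EFinM -lee_pdivrMr// muleC.
Qed.

(* P u is an eigenvector, so |P u|_q <= D |P u|; moreover
   |P u|^2 = <P u, u> <= |P u|_q |u|'_q, hence |P u|_q <= D^2 |u|'_q. *)
Lemma eigenprojection_opnorm (q : nat) (e : R) : 0 < e -> exists K delta : R,
  [/\ 0 < K, 0 < delta <= e &
    forall lambda P, lambda != 0 -> eigenprojection x lambda P ->
      (opnorm q P <= (K * normc lambda `^ (- delta))%:E)%E].
Proof.
move=> e0.
have [m hm] : exists m : nat, 2 / e <= (2 ^ m)%:R.
  exists (Num.bound (2 / e)).
  apply: le_trans (ltW (archi_boundP _)) _; first by rewrite divr_ge0// ltW.
  by rewrite ler_nat ltnW// ltn_expl.
(* Twice 2^-m, as the projection will be bounded by [D * D]; [m] was chosen to make this at most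
   [e]. *)
pose delta : R := (2 ^ m)%:R^-1 + (2 ^ m)%:R^-1.
have m0 : 0 < (2 ^ m)%:R :> R by rewrite ltr0n expn_gt0.
have d0 : 0 < delta by rewrite addr_gt0 ?invr_gt0.
have [K K0 hK] := eigenvector_norm q m.
exists (K `^ delta), delta; split; first exact: powR_gt0.
  rewrite d0 /delta -mulr2n -[_ *+ 2]mulr_natl ler_pdivrMr//.
  by move: hm; rewrite ler_pdivrMr// mulrC.
move=> lambda P l0 [[lP cP PP Psa] _ TP PT].
have nl : 0 < normc lambda by rewrite normc_gt0.
set D := (K / normc lambda) `^ (2 ^ m)%:R^-1.
have D0 : 0 <= D by exact: powR_ge0.
have -> : K `^ delta * normc lambda `^ (- delta) = D * D.
  rewrite -powRD; last by rewrite gt_eqF// divr_gt0.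
  rewrite powRM ?invr_ge0 ?(ltW K0) ?(ltW nl)//; congr (_ * _).
  by rewrite -(powR_inv1 (ltW nl)) -powRrM mulN1r.
have [B B0 hB] := smooth_bound P q q.
apply: (opnorm_le_l2 _ B0 _ hB); first by move=> xi eta; rewrite linearD.
  exact: mulr_ge0.
move=> u u1; pose w := restr_l2 P u.
have Tw : restr_l2 x w = lambda *: w by exact: TP.
have hw := hK _ _ l0 Tw; have wf := eigenvector_fin q l0 Tw.
have nw : nrm w <= D.
  apply: nrm_sqr_le => //.
  have h : inner w w = inner w u by rewrite -(Psa w u) PP.
  have := weighted_cauchy_schwarz wf (wnorm_l2_fin q u).
  rewrite -h -nrm_sqr_inner normc_real ger0_norm ?sqr_ge0// -lee_fin => /le_trans; apply.
  rewrite -[leRHS]mule1; apply: lee_pmul => //; exact: wnorm_ge0.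
rewrite -[X in wnorm q X]/(l2_val w); apply: le_trans hw _.
by rewrite lee_fin ler_wpM2l.
Qed.

(** With delta <= theta / 2, absorbing the norm of P_n leaves |lambda_n|^s for s = theta - delta >
    0; decay of [lam] of an order p >= k / s then absorbs the power k of n + 1. *)
Lemma eigenprojection_decay lam (P : nat -> smooth_op R) :
  lam \in @in_s R -> (forall n, lam n != 0) ->
  (forall n, eigenprojection x (lam n) (P n)) ->
  forall (q : nat) (theta : R) (k : nat), 0 < theta -> exists2 C : R, 0 < C &
    forall n, normc (lam n) `^ theta * fine (opnorm q (P n)) * n.+1%:R ^+ k <= C.
Proof.
move=> lams lam0 hP q theta k th0.
have [|K [delta [K0 /andP[d0 dth] hK]]] := @eigenprojection_opnorm q (theta / 2).
  by rewrite divr_gt0.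
pose s := theta - delta; have s0 : 0 < s by rewrite /s; lra.
have [p hp] : exists p : nat, k%:R / s <= p%:R.
  exists (Num.bound (k%:R / s)); apply/ltW/archi_boundP.
  by rewrite divr_ge0// ltW.
have [C C0 hC] := in_s_decay p lams.
exists (K * C `^ s) => [|n]; first by rewrite mulr_gt0 ?powR_gt0.
have nl : 0 < normc (lam n) by rewrite normc_gt0.
have oK := hK _ _ (lam0 n) (hP n).
have of_ : fine (opnorm q (P n)) <= K * normc (lam n) `^ (- delta).
  rewrite -lee_fin fineK// ge0_fin_numE ?opnorm_ge0//.
  by apply: le_lt_trans oK _; rewrite ltry.
apply: (@le_trans _ _ (K * (normc (lam n) `^ s * n.+1%:R ^+ k))).
  rewrite mulrA ler_wpM2r ?exprn_ge0//.
  apply: le_trans (ler_wpM2l (powR_ge0 _ _) of_) _.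
  by rewrite mulrCA /s powRD// gt_eqF// implybT.
rewrite ler_pM2l//; apply: (@le_trans _ _ ((normc (lam n) * n.+1%:R ^+ p) `^ s)).
  rewrite powRM ?(ltW nl) ?exprn_ge0// ler_wpM2l ?powR_ge0//.
  rewrite -!powR_mulrn// -powRrM; apply: ler_powR; first by rewrite ler1n.
  by rewrite -ler_pdivrMr.
by apply: ge0_ler_powR; rewrite ?nnegrE ?(ltW s0) ?(ltW C0) ?mulr_ge0 ?exprn_ge0 ?normc_ge0.
Qed.

End Eigen.
End RapidDecay.

(** * The spectral representation *)

Section SpectralRepresentation.
Variable R : realType.
Local Notation H := (l2_space R).
Implicit Types (u v w : H) (lam mu : nat -> R[i]) (P Q : nat -> smooth_op R).

Lemma truncD J (a b : nat -> R[i]) : trunc J (a + b) = trunc J a + trunc J b.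
Proof.
apply/funext => j; rewrite -[RHS]/(trunc J a j + trunc J b j) /trunc.
by case: ifP => // _; rewrite addr0.
Qed.

Lemma smooth_sum_bound lam P (q N : nat) : exists2 B : R, 0 < B &
  forall xi, (wnorm q (\sum_(0 <= n < N) lam n *: P n xi)%R <= B%:E * wnorm (- q%:Z) xi)%E.
Proof.
elim: N => [|N [B B0 hB]].
  exists 1 => // xi; rewrite big_geq// [leLHS]wnorm0 mule_ge0 ?wnorm_ge0//.
have [C C0 hC] := smooth_bound (P N) q q.
exists (B + (normc (lam N) + 1) * C).
  by rewrite addr_gt0// mulr_gt0// ltr_wpDl ?normc_ge0.
move=> xi; rewrite big_nat_recr//=; apply: le_trans (wnormD _ _ _) _.
have D0 : 0 <= (normc (lam N) + 1) * C by rewrite mulr_ge0 ?addr_ge0 ?normc_ge0 ?ltW.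
rewrite EFinD ge0_muleDl ?lee_fin ?(ltW B0)//; apply: leeD => //.
rewrite [leLHS](wnormZ q) EFinM -muleA; apply: lee_pmul => //.
- by rewrite lee_fin normc_ge0.
- exact: wnorm_ge0.
- by rewrite lee_fin lerDl.
Qed.

Lemma nonincreasing_normc lam : (forall n, normc (lam n.+1) <= normc (lam n)) ->
  forall m n, (m <= n)%N -> normc (lam n) <= normc (lam m).
Proof.
move=> h m n; elim: n => [|n IH]; first by rewrite leqn0 => /eqP ->.
by rewrite leq_eqVlt => /orP[/eqP ->//|/IH]; exact: le_trans.
Qed.

Lemma spectral_term_opnorm (x : smooth_op R) lam P : lam \in @in_s R ->
  (forall n, lam n != 0) -> (forall n, eigenprojection x (lam n) (P n)) ->
  forall q : nat, exists2 C : R, 0 < C & forall n,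
    (opnorm q (fun xi => lam n *: P n xi) <= (C * (n.+1%:R ^+ 2)^-1)%:E)%E.
Proof.
move=> lams lam0 hP q.
have [C C0 hC] := eigenprojection_decay lams lam0 hP q 2 ltr01.
exists C => // n; have [B B0 hB] := opnorm_fin q (P n).
apply: le_trans (opnormZ (C := fine (opnorm q (P n))) (lam n) _) _.
  by rewrite fineK// ge0_fin_numE ?opnorm_ge0// (le_lt_trans hB)// ltry.
rewrite lee_fin ler_pdivlMr ?exprn_gt0//; have := hC n.
by rewrite powRr1 ?normc_ge0.
Qed.

(** Summing the term bounds from N on gives 2C / (N + 1), but that the terms sum to [x] is known
    only in [l_2]. On the first J coordinates |.|_q is at most (J + 1)^q times the [l_2] norm, so
    for fixed J the remainder after M terms is negligible for large M; the resulting bound is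
    independent of J. *)
Lemma spectral_opnorm_cvg (x : smooth_op R) lam P : lam \in @in_s R ->
  (forall n, lam n != 0) -> (forall n, eigenprojection x (lam n) (P n)) ->
  (forall N u, nrm (restr_l2 x u - \sum_(0 <= n < N) lam n *: restr_l2 (P n) u) <=
     2 * normc (lam N) * nrm u) ->
  forall q : nat, opnorm q (fun xi => x xi - \sum_(0 <= n < N) lam n *: P n xi)
    @[N --> \oo] --> 0%E.
Proof.
move=> lams lam0 hP hrem q.
have [C C0 hC] := spectral_term_opnorm lams lam0 hP q.
have [C1 C10 hC1] := in_s_decay 1 lams.
suff key N : (opnorm q (fun xi => (x xi - \sum_(0 <= n < N) lam n *: P n xi)%R)
    <= (C * (2 / N.+1%:R))%:E)%E.
  apply: (@squeeze_cvge _ _ _ _ (fun=> 0%E) _ (fun N => (C * (2 / N.+1%:R))%:E)).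
  - by apply: nearW => N; rewrite opnorm_ge0 key.
  - exact: cvg_cst.
  apply: cvg_EFin; first by apply: nearW.
  rewrite [X in _ --> X](_ : 0 = C * (2 * 0)); last by rewrite !mulr0.
  apply: cvgM; first exact: cvg_cst.
  by apply: cvgM; [exact: cvg_cst|exact: cvg_harmonic].
have [B B0 hB] := smooth_bound x q q.
have [B' B'0 hB'] := smooth_sum_bound lam P q N.
apply: (@opnorm_le_l2 R q _ (B + B')).
- move=> xi eta; rewrite linearD; under eq_bigr do rewrite linearD scalerDr.
  by rewrite big_split /= opprD addrACA.
- exact: addr_gt0.
- by rewrite mulr_ge0 ?divr_ge0 ?ltW.
- move=> xi; apply: le_trans (wnormD _ _ _) _; rewrite wnormN.
  rewrite EFinD ge0_muleDl ?lee_fin ?(ltW B0) ?(ltW B'0)//.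
  exact: (leeD (hB xi) (hB' xi)).
move=> u u1; apply: wnorm_le_trunc; first by rewrite mulr_ge0 ?divr_ge0 ?ltW.
move=> J; apply/lee_addgt0Pr => e e0.
(* The truncated remainder after [M] terms is at most |lam M| K <= C1 K / (M + 1); the summand 1
   keeps [K] positive. *)
pose K := J.+1%:R ^+ q * (2 * nrm u + 1) : R.
have K0 : 0 < K by rewrite mulr_gt0 ?exprn_gt0// ltr_wpDl ?mulr_ge0 ?nrm_ge0.
have [M NM hM] : exists2 M : nat, (N <= M)%N & C1 * K / e <= M.+1%:R.
  exists (maxn N (Num.bound (C1 * K / e))); first exact: leq_maxl.
  apply: le_trans (ltW (archi_boundP _)) _.
    by rewrite ltW// divr_gt0// mulr_gt0.
  by rewrite ler_nat ltnW// ltnS leq_maxr.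
pose g M := x (l2_to_sdual u) - \sum_(0 <= n < M) lam n *: P n (l2_to_sdual u).
have gE : g N = \sum_(N <= n < M) lam n *: P n (l2_to_sdual u) + g M.
  have cat : \sum_(0 <= n < M) lam n *: P n (l2_to_sdual u) =
      \sum_(0 <= n < N) lam n *: P n (l2_to_sdual u) +
      \sum_(N <= n < M) lam n *: P n (l2_to_sdual u) by exact: big_cat_nat.
  by rewrite /g cat opprD (addrA (x _)) [RHS]addrC subrK.
rewrite -[X in trunc J X]/(s_val (g N)) gE.
rewrite -[X in trunc J X]/(s_val (\sum_(N <= n < M) lam n *: P n (l2_to_sdual u)) + s_val (g M)).
rewrite truncD; apply: le_trans (wnormD _ _ _) _; apply: leeD.
  apply: le_trans (wnorm_trunc _ _ _) _.
  apply: (@le_trans _ _ (\sum_(N <= n < M) C * (n.+1%:R ^+ 2)^-1)%:E); last first.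
    by rewrite -mulr_sumr lee_fin ler_pM2l// sum_inv_sqr_le.
  elim/big_rec2 : _ => [|n y1 y2 _ h]; first by rewrite [leLHS]wnorm0.
  apply: le_trans (wnormD _ _ _) _; rewrite EFinD; apply: leeD => //.
  apply: le_trans (hC n); apply: ereal_sup_ubound.
  exact: (ex_intro2 _ _ (l2_to_sdual u) u1 erefl).
apply: le_trans (wnorm_trunc_weight _ _ _) _.
have gl2 : s_to_l2 (g M) = restr_l2 x u - \sum_(0 <= n < M) lam n *: restr_l2 (P n) u.
  have -> : s_to_l2 (g M) = s_to_l2 (x (l2_to_sdual u)) -
      s_to_l2 (\sum_(0 <= n < M) lam n *: P n (l2_to_sdual u)) by exact: val_inj.
  rewrite s_to_l2_sum; congr (_ - _); apply: eq_bigr => n _; exact: val_inj.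
rewrite -[s_val (g M)]/(l2_val (s_to_l2 (g M))) gl2 wnorm0E -EFinM lee_fin.
apply: (@le_trans _ _ (normc (lam M) * K)).
  rewrite /K mulrCA ler_pM2l ?exprn_gt0//; apply: le_trans (hrem M u) _.
  by rewrite (mulrC 2) -mulrA ler_wpM2l ?normc_ge0// lerDl.
have := hC1 M; rewrite expr1 -ler_pdivlMr// => h.
apply: (@le_trans _ _ (C1 / M.+1%:R * K)); first by rewrite ler_pM2r.
by rewrite mulrAC ler_pdivrMr// -ler_pdivrMl// mulrC.
Qed.

Lemma spectral_representation_exists (x : smooth_op R) :
  normal_op (restr_l2 x) -> ~ finite_rank (restr_l2 x) ->
  exists lam P, spectral_representation x lam P.
Proof.
move=> [S xS Sx] inf_rank.
have /choice[Pc hPc] lambda : exists A, lambda != 0 -> eigenprojection x lambda A.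
  (* For lambda = 0 the operator [x] is a mere default value. *)
  have [l0|] := boolP (lambda != 0); last by exists x.
  by have [A hA] := eigenprojection_exists xS Sx l0; exists A.
have [lam [lam_inj lam_eig lam_dec lam_max]] := eigenvalue_enumeration xS Sx hPc inf_rank.
have lam0 n : lam n != 0 by have [] := lam_eig n.
pose P n := Pc (lam n).
have hP n : eigenprojection x (lam n) (P n) by exact: hPc.
have lam_le := nonincreasing_normc lam_dec.
have lams : lam \in @in_s R.
  (* The count is applied to lam 0, ..., lam n with threshold |lam n|, a lower bound for their
     moduli. *)
  apply: decay_in_s => k; have [C C0 hC] := eigenvalue_count xS Sx k.
  exists C => n; apply: (hC n lam) => //; first by rewrite normc_gt0.
    by move=> i im; split; [exact: lam_eig|exact: lam_le].
  by move=> i j _ _; exact: lam_inj.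
exists lam, P; split.
- by split.
- split=> [n|n|n|m n mn u]; [by case: (hP n)|by case: (hP n)| |].
    have [_ [v v0 Tv]] := lam_eig n; exists v.
    by have [_ _ _ h] := hP n; rewrite h.
  apply: inner_inj => z; rewrite inner0l.
  have [[_ _ _ Pm] _ TPm _] := hP m; have [_ _ TPn _] := hP n.
  rewrite Pm; apply: (eigenvectors_orthogonal xS Sx _ (TPn u) (TPm z)).
  by apply/eqP => /lam_inj nm; apply: mn.
- move=> q; have [C C0 hC] := spectral_term_opnorm lams lam0 hP q.
  apply: (@le_lt_trans _ _ (C * 2)%:E); last exact: ltry.
  apply: lime_le; first by apply: is_cvg_nneseries => n _ _; exact: opnorm_ge0.
  apply: nearW => N; apply: (@le_trans _ _ (\sum_(0 <= n < N) C * (n.+1%:R ^+ 2)^-1)%:E).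
    by rewrite -sumEFin; apply: lee_sum => n _; exact: (hC n).
  rewrite lee_fin -mulr_sumr ler_pM2l//; apply: le_trans (sum_inv_sqr_le _ 0 N) _.
  by rewrite divr1.
apply: spectral_opnorm_cvg => // N u.
have -> : \sum_(0 <= n < N) lam n *: restr_l2 (P n) u =
          \sum_(l <- mkseq lam N) l *: restr_l2 (Pc l) u.
  by rewrite /mkseq big_map /index_iota subn0.
apply: (nrm_remainder_le xS Sx hPc).
- by rewrite map_inj_uniq ?iota_uniq.
- by move=> l /mapP[n _ ->].
- exact: normc_ge0.
- exact: lam_max.
Qed.

Lemma nrm_small_eq0 v (c : R) : 0 <= c -> (forall e : R, 0 < e -> nrm v <= e * c) -> v = 0.
Proof.
move=> c0 h; apply/eqP; rewrite -nrm_eq0 eq_le nrm_ge0 andbT.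
apply/ler_addgt0Pr => e e0; rewrite add0r.
have c1 : 0 < c + 1 by rewrite ltr_wpDl.
apply: le_trans (h (e / (c + 1)) _) _; first by rewrite divr_gt0.
by rewrite mulrAC ler_pdivrMr// ler_pM2l// lerDl.
Qed.

(** * Eigenvalues and eigenprojections recovered from a representation *)

Section Analysis.
Variables (x : smooth_op R) (lam : nat -> R[i]) (P : nat -> smooth_op R).
Hypothesis rep : spectral_representation x lam P.
Let T := restr_l2 x.
Let p n := restr_l2 (P n).
Let pl n : linear (p n) := @restr_linear R (P n).

(** For q = 0, convergence in [opnorm] is convergence in the operator norm of [l_2]. *)
Lemma representation_restr_cvg u (e : R) : 0 < e -> exists N0, forall N, (N0 <= N)%N ->
  nrm (T u - \sum_(0 <= n < N) lam n *: p n u) <= e * nrm u.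
Proof.
move=> e0; have [_ _ _ /(_ 0%N) hcv] := rep.
have [N0 _ hN0] := hcv _ (@open_ereal_lt' R 0%E e%:E e0).
exists N0 => N /hN0 /= /ltW oN; pose f xi := x xi - \sum_(0 <= n < N) lam n *: P n xi.
have fZ a xi : f (a *: xi) = a *: f xi.
  rewrite /f linearZ scalerBr scaler_sumr; congr (_ - _); apply: eq_bigr => n _.
  by rewrite linearZ !scalerA mulrC.
have u0 : (wnorm (- 0%N%:Z) u < +oo)%E by rewrite oppr0 wnorm0E ltry.
have := opnorm_boundE (xi := l2_to_sdual u) fZ oN (ltW e0) u0.
rewrite [X in wnorm X (l2_to_sdual u)]oppr0 wnorm0E.
rewrite -[s_val (f _)]/(l2_val (s_to_l2 (f (l2_to_sdual u)))) wnorm0E -EFinM lee_fin.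
congr (nrm _ <= _).
have -> : s_to_l2 (f (l2_to_sdual u)) = s_to_l2 (x (l2_to_sdual u)) -
      s_to_l2 (\sum_(0 <= n < N) lam n *: P n (l2_to_sdual u)) by exact: val_inj.
rewrite s_to_l2_sum; congr (_ - _); apply: eq_bigr => n _; exact: val_inj.
Qed.

Lemma representation_eigenvector m u : p m u = u -> T u = lam m *: u.
Proof.
have [_ [prP _ _ orP] _ _] := rep.
move=> pu; apply/eqP; rewrite -subr_eq0; apply/eqP.
apply: (@nrm_small_eq0 _ (nrm u)); first exact: nrm_ge0.
move=> e e0; have [N0 hN] := representation_restr_cvg u e0.
(* The maximum ensures that the index [m] occurs in the partial sum, which then equals its [m]-th
   term. *)
have := hN (maxn N0 m.+1) (leq_maxl _ _).
rewrite (bigD1_seq m) ?iota_uniq ?mem_index_iota ?leq_maxr//= pu big1 ?addr0//.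
by move=> n nm; rewrite -pu /p orP ?scaler0//; apply/eqP.
Qed.

(** [p n] is bounded, so it may be applied to the series term by term, and orthogonality leaves only
    the n-th term. *)
Lemma representation_commute n u : p n (T u) = lam n *: p n u.
Proof.
have [_ [prP _ _ orP] _ _] := rep.
apply/eqP; rewrite -subr_eq0; apply/eqP.
have [[B B0 hB] _] := restr_compact_like (P n).
apply: (@nrm_small_eq0 _ (B * nrm u)); first by rewrite mulr_ge0 ?nrm_ge0// ltW.
move=> e e0; have [N0 hN] := representation_restr_cvg u e0.
have := hN (maxn N0 n.+1) (leq_maxl _ _).
set SN := \sum_(_ <= _ < _) _ => h.
have <- : p n (T u - SN) = p n (T u) - lam n *: p n u.
  rewrite linB//; congr (_ - _); rewrite /SN lin_sum//.
  rewrite (bigD1_seq n) ?iota_uniq ?mem_index_iota ?leq_maxr//=.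
  rewrite linZ// big1 ?addr0 => [|k kn]; last first.
    by rewrite linZ// /p orP ?scaler0//; apply/eqP; rewrite eq_sym.
  by have [_ _ pp _] := prP n; rewrite [p n (p n u)]pp.
by apply: le_trans (hB _) _; rewrite mulrCA ler_pM2l.
Qed.

(** By [representation_commute], [p n u] vanishes unless [l = lam n]. If this never happened, the
    series would give T u = 0; otherwise a single term survives, as [lam] is injective, and l u = l
    (p m u). *)
Lemma representation_spectrum l u : l != 0 -> u != 0 -> T u = l *: u ->
  exists n, l = lam n /\ p n u = u.
Proof.
move=> l0 u0 Tu.
have pn0 n : l != lam n -> p n u = 0.
  move=> ln; have := representation_commute n u; rewrite Tu linZ// => /eqP.
  by rewrite -subr_eq0 -scalerBl scaler_eq0 subr_eq0 (negPf ln) => /eqP.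
have [m lm] : exists m, l = lam m.
  apply: contrapT => /forallNP hl; move: u0; apply/negP; rewrite negbK.
  suff : T u = 0 by rewrite Tu => /eqP; rewrite scaler_eq0 (negPf l0).
  apply: (@nrm_small_eq0 _ (nrm u)); first exact: nrm_ge0.
  move=> e e0; have [N0 hN] := representation_restr_cvg u e0.
  have := hN N0 (leqnn _); rewrite big1 ?subr0// => n _.
  by rewrite pn0 ?scaler0//; apply/eqP; exact: hl.
exists m; split => //; apply: (scalerI l0); rewrite -Tu {1}lm; apply/esym/eqP.
rewrite -subr_eq0; apply/eqP.
apply: (@nrm_small_eq0 _ (nrm u)); first exact: nrm_ge0.
move=> e e0; have [N0 hN] := representation_restr_cvg u e0.
have := hN (maxn N0 m.+1) (leq_maxl _ _).
rewrite (bigD1_seq m) ?iota_uniq ?mem_index_iota ?leq_maxr//= big1 ?addr0// => n nm.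
rewrite pn0 ?scaler0// lm; have [[_ _ linj _] _ _ _] := rep.
by apply: contra nm => /eqP /linj ->.
Qed.

Lemma representation_eigenprojection n : eigenprojection x (lam n) (P n).
Proof.
have [[_ lam0 linj _] [prP frP _ _] _ _] := rep.
have [_ _ pp _] := prP n; split => //.
  by move=> u; apply: representation_eigenvector; exact: pp.
move=> u Tu; have [->|u0] := eqVneq u 0; first exact: lin0 (pl n).
by have [m [/linj <-]] := representation_spectrum (lam0 n) u0 Tu.
Qed.

End Analysis.

(** On [l_2] each projection fixes the range of the other, so B A = A and A B = B; taking adjoints
    in the first gives A = A B = B. *)
Lemma eigenprojection_unique (x : smooth_op R) l (A B : smooth_op R) :
  eigenprojection x l A -> eigenprojection x l B -> A =1 B.
Proof.
move=> [[_ _ _ sA] _ TA Aid] [[_ _ _ sB] _ TB Bid]; apply: restr_ext => u.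
apply: inner_inj => z.
by rewrite -(Bid _ (TA u)) sB sA (Aid _ (TB z)) -sB.
Qed.

(* Among the n + 1 indices sigma 0, ..., sigma n one is at least n. *)
Lemma rearrangement_le (f g : nat -> R) (sigma : nat -> nat) :
  (forall m n, (m <= n)%N -> f n <= f m) -> (forall m n, (m <= n)%N -> g n <= g m) ->
  injective sigma -> (forall n, g n = f (sigma n)) -> forall n, g n <= f n.
Proof.
move=> f_dec g_dec sI gf n.
have [i iN ni] : exists2 i, (i <= n)%N & (n <= sigma i)%N.
  apply: contrapT => h.
  have : (size (mkseq sigma n.+1) <= size (iota 0 n))%N.
    apply: uniq_leq_size; first by rewrite map_inj_uniq ?iota_uniq.
    move=> _ /mapP[i iN ->]; rewrite mem_iota /= add0n ltnNge; apply/negP => ni.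
    by apply: h; exists i => //; rewrite mem_iota add0n ltnS in iN.
  by rewrite size_mkseq size_iota ltnn.
by rewrite (le_trans (g_dec _ _ iN))// gf f_dec.
Qed.

(** Both sequences enumerate the nonzero eigenvalues injectively, hence differ by a bijection. Two
    decreasing rearrangements of the same moduli agree at each index, so |lam (sigma n)| = |mu n| =
    |lam n|. *)
Lemma spectral_representation_unique (x : smooth_op R) lam P mu Q :
  spectral_representation x lam P -> spectral_representation x mu Q ->
  exists2 sigma : nat -> nat, bijective sigma &
    forall n, [/\ normc (lam (sigma n)) = normc (lam n),
                  mu n = lam (sigma n) & Q n =1 P (sigma n)].
Proof.
move=> repP repQ.
have eig (l1 l2 : nat -> R[i]) (P1 P2 : nat -> smooth_op R) n :
    spectral_representation x l1 P1 -> spectral_representation x l2 P2 ->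
    exists m, l2 n = l1 m.
  move=> r1 r2; have [[_ l20 _ _] [_ _ /(_ n)[u pu0] _] _ _] := r2.
  have [_ _ TP _] := representation_eigenprojection r2 n.
  by have [m [lm _]] := representation_spectrum r1 (l20 n) pu0 (TP u); exists m.
have [sigma hs] := choice (fun n => eig _ _ _ _ n repP repQ).
have [tau ht] := choice (fun n => eig _ _ _ _ n repQ repP).
have [[_ _ lI ldec] _ _ _] := repP; have [[_ _ mI mdec] _ _ _] := repQ.
have st : cancel sigma tau by move=> n; apply: mI; rewrite -ht -hs.
have ts : cancel tau sigma by move=> n; apply: lI; rewrite -hs -ht.
exists sigma; first by exists tau.
have l_dec := nonincreasing_normc ldec; have m_dec := nonincreasing_normc mdec.
move=> n; split; [|exact: hs|]; last first.
  apply: (eigenprojection_unique (representation_eigenprojection repQ n)).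
  by rewrite hs; exact: representation_eigenprojection.
rewrite -hs; apply/eqP; rewrite eq_le.
rewrite (rearrangement_le l_dec m_dec (can_inj st)); last by move=> k; rewrite hs.
by rewrite (rearrangement_le m_dec l_dec (can_inj ts))// => k; rewrite ht.
Qed.

End SpectralRepresentation.

Theorem theorem3p1 (R : realType) (x : smooth_op R)
    (x_normal : normal_op (restr_l2 x))
    (x_infinite_rank : ~ finite_rank (restr_l2 x)) :
  [/\ exists lam P, spectral_representation x lam P,
      forall lam P mu Q,
        spectral_representation x lam P -> spectral_representation x mu Q ->
        exists2 sigma : nat -> nat, bijective sigma &
          forall n, [/\ normc (lam (sigma n)) = normc (lam n),
                        mu n = lam (sigma n) & Q n =1 P (sigma n)] &
      forall lam P, spectral_representation x lam P ->
        forall (q : nat) (theta : R), 0 < theta <= 1 ->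
          (fun n => (normc (lam n) `^ theta * fine (opnorm q (P n)))%:C)
            \in @in_s R].
Proof.
split; first exact: spectral_representation_exists.
  by move=> lam P mu Q; exact: spectral_representation_unique.
move=> lam P rep q theta /andP[theta0 _]; apply: decay_in_s => k.
have [[lams lam0 _ _] _ _ _] := rep.
have [C _ hC] := eigenprojection_decay lams lam0 (representation_eigenprojection rep) q k theta0.
exists C => n; rewrite normc_real ger0_norm ?hC//.
by rewrite mulr_ge0 ?powR_ge0// fine_ge0 ?opnorm_ge0.
Qed.
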